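(* Let $k\ge1$ be a fixed integer, $\lambda_1,\dots,\lambda_k>0$, and consider the risk model $X(t)=ct-\sum_{j=1}^{M(t)}Z_j$, $t\ge0$, where $c>0$ is the constant premium rate, $\{M(t)\}_{t\ge0}$ is the generalized counting process with rates $\lambda_1,\dots,\lambda_k$, and $\{Z_j\}_{j\ge1}$ is a sequence of positive iid random variables (the claim sizes) with common distribution $F$, independent of $\{M(t)\}_{t\ge0}$. Let $\mu=\mathbb{E}(Z_j)$. Then the ruin probability for zero initial capital is given by $$\psi(0)=\frac{\mu}{c}\sum_{j=1}^{k}j\lambda_{j}.$$
   Context: The generalized counting process (GCP) $\{M(t)\}_{t\ge0}$ with rates $\lambda_1,\dots,\lambda_k>0$ is the compound Poisson process (Lévy process started at $0$) with jumps of sizes $1,\dots,k$ occurring at rates $\lambda_1,\dots,\lambda_k$ respectively; i.e. $M(t)\overset{d}{=}\sum_{i=1}^{N(t)}X_i$ with $\{N(t)\}_{t\ge0}$ a Poisson process of intensity $\Lambda=\lambda_1+\dots+\lambda_k$ independent of the iid sequence $\{X_i\}_{i\ge1}$ with $\mathrm{Pr}\{X_1=j\}=\lambda_j/\Lambda$, $j=1,\dots,k$. For initial capital $u\ge0$ the surplus process is $U(t)=u+X(t)$, the time to ruin is $\tau=\inf\{t>0:U(t)<0\}$ with $\inf\emptyset=\infty$, and the ruin probability is $\psi(u)=\mathrm{Pr}\{\tau<\infty\}$.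
   Formalization: The formal statement assumes that μ is finite and that the net profit condition μ·Σ jλ_j ≤ c holds (equality allowed); otherwise the right-hand side exceeds 1 and the formula fails, e.g. k=1, λ_1=1, Z=2, c=1. *)

(* Defs.v *)
From HB Require Import structures.
From mathcomp Require Import all_boot all_order all_algebra.
From mathcomp Require Import all_classical all_reals all_analysis.
Import Order.TTheory GRing.Theory Num.Theory.
Import numFieldNormedType.Exports.

Set Implicit Arguments.
Unset Strict Implicit.
Unset Printing Implicit Defensive.

Local Open Scope classical_set_scope.
Local Open Scope ring_scope.

Definition mutually_independent d d' (T : measurableType d)
    (T' : measurableType d') (R : realType) (P : probability T R)
    (I : eqType) (X : I -> T -> T') : Prop :=
  forall (s : seq I) (B : I -> set T'), uniq s ->
    (forall i, measurable (B i)) ->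
    P (\bigcap_(i in [set` s]) (X i @^-1` B i)) =
    (\prod_(i <- s) P (X i @^-1` B i))%E.

Definition sigma_generated d d' (T : measurableType d)
    (T' : measurableType d') (I : Type) (D : set I) (X : I -> T -> T') :
    set (set T) :=
  <<s \bigcup_(i in D) preimage_set_system [set: T] (X i) measurable >>.

Definition independent_families d d1 d2 (T : measurableType d)
    (T1 : measurableType d1) (T2 : measurableType d2) (R : realType)
    (P : probability T R) (I : Type) (D : set I) (X : I -> T -> T1)
    (J : Type) (E : set J) (Y : J -> T -> T2) : Prop :=
  forall A B : set T, sigma_generated D X A -> sigma_generated E Y B ->
    P (A `&` B) = (P A * P B)%E.

Definition iid d d' (T : measurableType d) (T' : measurableType d')
    (R : realType) (P : probability T R) (X : nat -> T -> T') : Prop :=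
  mutually_independent P X /\
  forall (i j : nat) (B : set T'), measurable B ->
    P (X i @^-1` B) = P (X j @^-1` B).

(* Processes are functions on all of R, but only the times t >= 0 matter.
   Regularity of the paths is required everywhere, not just almost surely, so
   that events such as ruin, which involve uncountably many times, are
   measurable without completing P.  The increments along an infinite
   nondecreasing sequence of times are mutually independent iff those along
   each finite sequence are. *)
Definition levy_process d (T : measurableType d) (R : realType)
    (P : probability T R) (X : R -> T -> R) : Prop :=
  [/\ forall t : R, 0 <= t -> measurable_fun [set: T] (X t),
      {ae P, forall w, X 0 w = 0},
      forall t : nat -> R, 0 <= t 0%N ->
        {homo t : i j / (i <= j)%N >-> i <= j} ->
        mutually_independent P
          (fun (i : nat) (w : T) => X (t i.+1) w - X (t i) w),
      forall s t : R, 0 <= s -> s <= t -> forall B : set R, measurable B ->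
        P ((fun w => X t w - X s w) @^-1` B) = P (X (t - s) @^-1` B)
    & forall w : T,
        (forall t : R, 0 <= t -> X s w @[s --> t^'+] --> X t w) /\
        (forall t : R, 0 < t -> cvg (X s w @[s --> t^'-])) ].

(* The values are embedded in R because increments need a subtraction that is
   not truncated. *)
Definition poisson_process d (T : measurableType d) (R : realType)
    (P : probability T R) (rate : R) (N : R -> T -> nat) : Prop :=
  levy_process P (fun (t : R) (w : T) => (N t w)%:R) /\
  forall (t : R) (n : nat), 0 < t ->
    P (N t @^-1` [set n]) = (poisson_pmf (rate * t) n)%:E.

(* The rate [lam j] with j : 'I_k, hence j = 0, ..., k - 1, is that of the
   jumps of size j + 1.  The compound Poisson representation is an equality of
   laws, so N and X may live on another probability space. *)
Definition generalized_counting_process d (T : measurableType d)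
    (R : realType) (P : probability T R) (k : nat) (lam : 'I_k -> R)
    (M : R -> T -> nat) : Prop :=
  levy_process P (fun (t : R) (w : T) => (M t w)%:R) /\
  exists (d' : measure_display) (T' : measurableType d')
      (Q : probability T' R) (N : R -> {RV Q >-> nat})
      (X : nat -> {RV Q >-> nat}),
    [/\ poisson_process Q (\sum_(j < k) lam j) (fun t => N t),
        iid Q (fun i => X i),
        forall j : 'I_k, Q (X 0%N @^-1` [set j.+1]) =
          (lam j / \sum_(i < k) lam i)%:E,
        independent_families Q [set t : R | 0 <= t] (fun t => N t)
          [set: nat] (fun i => X i)
      & forall t : R, 0 <= t -> forall B : set nat,
          P (M t @^-1` B) =
          Q ((fun w => (\sum_(i < N t w) X i w)%N) @^-1` B)].

(* [Z j] is the claim number j + 1. *)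
Definition risk_model (T : Type) (R : realType) (c : R) (M : R -> T -> nat)
    (Z : nat -> T -> R) (t : R) (w : T) : R :=
  c * t - \sum_(j < M t w) Z j w.

Definition surplus (T : Type) (R : realType) (X : R -> T -> R) (u t : R)
    (w : T) : R :=
  u + X t w.

Definition ruin_time (T : Type) (R : realType) (X : R -> T -> R) (u : R)
    (w : T) : \bar R :=
  ereal_inf [set t%:E | t in [set t | 0 < t /\ surplus X u t w < 0]].

Definition ruin_probability d (T : measurableType d) (R : realType)
    (P : probability T R) (X : R -> T -> R) (u : R) : \bar R :=
  P [set w | (ruin_time X u w < +oo)%E].

(* Main.v *)
Require Import Defs.
From mathcomp Require Import all_boot all_order all_algebra.
From mathcomp Require Import all_classical all_reals all_analysis.
From mathcomp Require Import measurable_realfun.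
From mathcomp Require Import zify ring lra.
Import Order.TTheory GRing.Theory Num.Theory.
Import numFieldNormedType.Exports.

(** Let C(t) be the sum of the claims that arrived up to time t, and let rho
    be mu / c times the mean number of claims per unit of time.  Ruin is
    avoided exactly when C(t) <= c t for all t > 0, so it has to be shown that
    this event, called [survival] below, has probability 1 - rho.

    The reason is the ballot theorem of Takacs.  The increments of C over
    consecutive intervals of equal length are independent and identically
    distributed, so their joint law is invariant under rotations; among the
    rotations of a path on [0, t], the proportion of those that stay below
    the line of slope c is the positive part of 1 - C(t) / (c t).  Hence C
    stays below the line up to time t with probability
    E (1 - C(t) / (c t))^+, and this expectation tends to 1 - rho because
    C(t) / (c t) tends to rho <= 1 by the law of large numbers.

    To use only the elementary [cycle_lemma] for walks with integer steps,
    the claims are rounded to multiples of delta and time is sampled at the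
    multiples of h, where delta = slope * h: in units of delta, the premium
    earned per step is 1 and the claims paid per step form a sequence Y of
    natural numbers.  That Y is independent and identically distributed is
    [compound_increments_iid]; its mean follows from Wald's identity, applied
    once to the claims and once to the compound Poisson representation of the
    counting process ([wald], [counting_process_mean]).  Averaging the cycle
    lemma over the rotations ([ballot_massE]) yields [ballot_prob_ge] and
    [ballot_prob_le].  In the lower bound the law of large numbers is not
    used: the positive part is at least 1 - C(t) / (c t), whose expectation is
    already 1 - rho.  In the upper bound it enters through Chebyshev's
    inequality for capped increments.

    Rounding up with slope c bounds survival on each dyadic grid from below,
    and right-continuity makes survival the decreasing intersection of
    these events.  Rounding down with a slope c' > c bounds survival from
    above; the strict inequality c < c' pays for the strict inequality in the
    cycle lemma.  Letting delta tend to 0 and c' to c closes the gap. *)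

Set Implicit Arguments.
Unset Strict Implicit.
Unset Printing Implicit Defensive.

Local Open Scope classical_set_scope.
Local Open Scope ring_scope.

(** * The cycle lemma *)

(** A ballot sequence is strict: the walk with steps [1 - x l] stays positive
    from time 1 to time [n].  Strictness is what makes the count in
    [cycle_lemma] exact. *)
Definition ballot (n : nat) (x : nat -> nat) : bool :=
  [forall m : 'I_n, (\sum_(l < m.+1) x l < m.+1)%N].

Lemma ballotP n (x : nat -> nat) : reflect
  (forall m, (m < n)%N -> (\sum_(l < m.+1) x l < m.+1)%N) (ballot n x).
Proof.
apply: (iffP forallP) => [h m mn|h m]; first exact: (h (Ordinal mn)).
exact: h.
Qed.

Section cycle_lemma.
Variables (n : nat) (x : nat -> nat).
Hypothesis x_periodic : forall i, x (i + n.+1)%N = x i.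

Let walk (i : nat) : int := i%:Z - (\sum_(l < i) x l)%N%:Z.

Let walkS i : walk i.+1 = walk i + 1 - (x i)%:Z.
Proof. by rewrite /walk big_ord_recr /= PoszD; lia. Qed.

Let walkD i m : walk (i + m)%N = walk i + m%:Z - (\sum_(l < m) x (i + l))%N%:Z.
Proof.
elim: m => [|m IH]; first by rewrite big_ord0 addn0; lia.
by rewrite addnS walkS IH big_ord_recr /=; lia.
Qed.

Let drift := walk n.+1.

Let walk_period i : walk (i + n.+1)%N = walk i + drift.
Proof.
elim: i => [|i IH]; first by rewrite add0n /drift {2}/walk big_ord0; lia.
by rewrite addSn !walkS IH x_periodic; lia.
Qed.

(** For [k = n] and nonnegative drift, this is the minimum of the walk over
    all times from [r] on. *)
Fixpoint walk_min (r k : nat) : int :=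
  if k is k'.+1 then Num.min (walk r) (walk_min r.+1 k') else walk r.

Let walk_minS r k :
  walk_min r k.+1 = Num.min (walk_min r k) (walk (r + k.+1)%N).
Proof.
elim: k r => [|k IH] r; first by rewrite /= addn1.
by rewrite [LHS]/= -/(walk_min r.+1 k.+1) IH minA /= addSnnS.
Qed.

Let lt_walk_min v r k :
  (v < walk_min r k) = [forall j : 'I_k.+1, v < walk (r + j)%N].
Proof.
elim: k r => [|k IH] r /=.
  apply/idP/forallP => [h j|/(_ ord0)]; last by rewrite addn0.
  by rewrite ord1 addn0.
rewrite lt_min IH; apply/andP/forallP => [[h0 /forallP h] j|h].
  case: (unliftP ord0 j) => [j' ->|->]; last by rewrite addn0.
  by have := h j'; rewrite /= /bump /= add1n addSnnS.
split; first by have := h ord0; rewrite addn0.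
by apply/forallP => j; have := h (lift ord0 j); rewrite /= /bump /= add1n addSnnS.
Qed.

Let ballot_shiftE r :
  ballot n.+1 (fun l => x (r + l)%N) = (walk r < walk_min r.+1 n).
Proof.
rewrite lt_walk_min; apply: eq_forallb => m.
rewrite addSnnS walkD; lia.
Qed.

(** The walk goes up by at most 1 per step.  Hence its future minimum goes up,
    from [r] to [r + 1], by 1 if the walk stays above its value at [r] from
    then on, which says that the rotation by [r] is a ballot sequence, and by
    0 otherwise.  Over one period the future minimum goes up by the drift, which
    therefore counts these rotations.  If the drift is not positive there are
    none. *)
Lemma cycle_lemma :
  (\sum_(r < n.+1) ballot n.+1 (fun l => x (r + l)))%N =
  (n.+1 - \sum_(l < n.+1) x l)%N.
Proof.
have [d0|d0] := leP drift 0.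
  rewrite big1 => [|r _]; first by rewrite /drift /walk in d0; lia.
  apply/eqP; rewrite eqb0; apply/negP => /ballotP /(_ n (ltnSn n)).
  by have := walkD r n.+1; rewrite walk_period; lia.
have stepE r : walk_min r n = Num.min (walk r) (walk_min r.+1 n).
  rewrite -[RHS]/(walk_min r n.+1) walk_minS walk_period.
  rewrite min_l //; apply: (@le_trans _ _ (walk r)); last by lia.
  by case: (n) => //= n'; rewrite ge_min lexx.
have incr r : walk_min r.+1 n =
    walk_min r n + (ballot n.+1 (fun l => x (r + l)%N))%:Z.
  rewrite (stepE r) ballot_shiftE.
  have : walk_min r.+1 n - 1 <= walk r.
    have : walk_min r.+1 n <= walk r.+1.
      by case: (n) => //= n'; rewrite ge_min lexx.
    by rewrite walkS; lia.
  by case: ltP; lia.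
have period_min r k : walk_min (r + n.+1) k = walk_min r k + drift.
  elim: k r => [|k IH] r /=; first exact: walk_period.
  by rewrite -addSn IH walk_period addr_minl.
have tot k : walk_min k n = walk_min 0 n +
    (\sum_(r < k) ballot n.+1 (fun l => x (r + l)))%N%:Z.
  elim: k => [|k IH]; first by rewrite big_ord0 addr0.
  by rewrite big_ord_recr incr IH PoszD addrA.
have := tot n.+1; rewrite (_ : walk_min n.+1 n = walk_min 0 n + drift);
  last by rewrite -period_min.
move/addrI; rewrite /drift /walk in d0 * => E.
by apply/eqP; rewrite -eqz_nat -E; lia.
Qed.
End cycle_lemma.

(** * Ballot words with independent letters *)

(** Words of length [n + 1] over the letters 0, ..., L are weighted by the
    product of the masses of their letters.  This finite setting is enough
    because the increments can be capped: see [ballot_prob_ge] and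
    [ballot_prob_le]. *)
Section finite_ballot.
Variables (R : realFieldType) (L n : nat) (p : 'I_L.+1 -> R).
Hypothesis p_ge0 : forall a, 0 <= p a.
Hypothesis p_sum1 : \sum_a p a = 1.

Let word := {ffun 'I_n.+1 -> 'I_L.+1}.
Let weight (y : word) : R := \prod_i p (y i).

(** [inZp] reduces the index modulo [n + 1], so that the word is repeated
    periodically, as [cycle_lemma] requires. *)
Definition cyclic_ext (y : {ffun 'I_n.+1 -> 'I_L.+1}) (l : nat) : nat := y (inZp l).

Let mean : R := \sum_a p a * a%:R.
Let var : R := \sum_a p a * (a%:R - mean) ^+ 2.

Let weight_ge0 y : 0 <= weight y.
Proof. by apply: prodr_ge0 => i _; exact: p_ge0. Qed.

Let cyclic_ext_sum y : (\sum_(l < n.+1) cyclic_ext y l = \sum_i y i)%N.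
Proof. by apply: eq_bigr => i _; rewrite /cyclic_ext valZpK. Qed.

Definition rotate_word (r : 'I_n.+1) (y : word) : word := [ffun i => y (r + i)].

Let cyclic_ext_rotate r y l : cyclic_ext (rotate_word r y) l = cyclic_ext y (r + l).
Proof.
rewrite /cyclic_ext ffunE; congr (nat_of_ord (y _)); apply: val_inj => /=.
by rewrite modnDmr.
Qed.

Let rotate_word_bij r : bijective (rotate_word r).
Proof.
exists (rotate_word (- r)) => y; apply/ffunP => i; rewrite !ffunE; congr (y _).
  by rewrite addNKr.
by rewrite addKr.
Qed.

Let weight_rotate r y : weight (rotate_word r y) = weight y.
Proof.
rewrite /weight [RHS](reindex (fun i => r + i)) /=.
  by apply: eq_bigr => i _; rewrite ffunE.
by exists (fun i => - r + i) => i _; rewrite ?addKr ?addNKr.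
Qed.

Definition ballot_mass : R :=
  \sum_(y : word) \prod_i p (y i) * (ballot n.+1 (cyclic_ext y))%:R.

(** Rotations preserve the weights.  The mass of the ballot words is
    therefore its own average over the rotated words, and for each word the
    cycle lemma counts the rotations that contribute.  The subtraction is
    truncated, hence the right-hand side is an expected positive part. *)
Lemma ballot_massE : n.+1%:R * ballot_mass =
  \sum_(y : word) \prod_i p (y i) * (n.+1 - \sum_i y i)%:R.
Proof.
transitivity (\sum_(r : 'I_n.+1) \sum_(y : word) weight y *
    (ballot n.+1 (cyclic_ext (rotate_word r y)))%:R).
  rewrite -[n.+1 in LHS]card_ord -sumr_const mulr_suml; apply: eq_bigr => r _.
  rewrite mul1r /ballot_mass (reindex (rotate_word r)) /=.
    by apply: eq_bigr => y _; rewrite -/(weight _) weight_rotate.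
  by apply: onW_bij; exact: rotate_word_bij.
rewrite exchange_big; apply: eq_bigr => y _ /=.
rewrite -mulr_sumr -cyclic_ext_sum; congr (_ * _).
rewrite -cycle_lemma => [|i]; last first.
  by rewrite /cyclic_ext; congr (nat_of_ord (y _)); apply: val_inj; rewrite /= modnDr.
rewrite natr_sum; apply: eq_bigr => r _; congr (nat_of_bool _)%:R.
by apply: eq_forallb => m; congr (_ < _)%N; apply: eq_bigr => l _.
Qed.

Let weight_prod (f : 'I_n.+1 -> 'I_L.+1 -> R) :
  \sum_(y : word) weight y * \prod_i f i (y i) = \prod_i \sum_a p a * f i a.
Proof.
rewrite bigA_distr_bigA; apply: eq_bigr => y _.
by rewrite -big_split.
Qed.

Let weight_sum1 : \sum_(y : word) weight y = 1.
Proof.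
rewrite -(bigA_distr_bigA (fun=> p)) /=; under eq_bigr do rewrite p_sum1.
by rewrite big1.
Qed.

Let weight_coord i (f : 'I_L.+1 -> R) :
  \sum_(y : word) weight y * f (y i) = \sum_a p a * f a.
Proof.
pose g j a := if j == i then f a else 1.
transitivity (\sum_(y : word) weight y * \prod_j g j (y j)).
  apply: eq_bigr => y _; congr (_ * _); rewrite (bigD1 i) //= /g eqxx.
  by rewrite big1 ?mulr1 // => j /negPf ->.
rewrite weight_prod (bigD1 i) //= [X in _ * X]big1 => [|j /negPf ji].
  by rewrite mulr1 /g eqxx.
by rewrite /g ji; under eq_bigr do rewrite mulr1.
Qed.

Let weight_coord2 i j (f : 'I_L.+1 -> R) : i != j ->
  \sum_(y : word) weight y * (f (y i) * f (y j)) = (\sum_a p a * f a) ^+ 2.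
Proof.
move=> ij; pose g l a := if l == i then f a else if l == j then f a else 1.
transitivity (\sum_(y : word) weight y * \prod_l g l (y l)).
  apply: eq_bigr => y _; congr (_ * _).
  rewrite (bigD1 i) //= (bigD1 j) 1?eq_sym //= /g eqxx eq_sym (negPf ij) eqxx.
  by rewrite big1 ?mulr1 // => l /andP[/negPf -> /negPf ->].
rewrite weight_prod (bigD1 i) //= (bigD1 j) 1?eq_sym //=.
rewrite [X in _ * (_ * X)]big1 => [|l /andP[/negPf li /negPf lj]].
  by rewrite mulr1 expr2 /g eqxx eq_sym (negPf ij) eqxx.
by rewrite /g li lj; under eq_bigr do rewrite mulr1.
Qed.

Let weight_mean : \sum_(y : word) weight y * (\sum_i y i)%:R = n.+1%:R * mean.
Proof.
under eq_bigr do rewrite natr_sum mulr_sumr.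
rewrite exchange_big /=; under eq_bigr do rewrite (weight_coord _ (fun a => a%:R)).
by rewrite sumr_const card_ord mulr_natl.
Qed.

(** The mixed terms of the squared sum factor into products of centred
    means and vanish. *)
Let weight_var :
  \sum_(y : word) weight y * ((\sum_i y i)%:R - n.+1%:R * mean) ^+ 2 = n.+1%:R * var.
Proof.
pose f (a : 'I_L.+1) : R := a%:R - mean.
have Ef : \sum_a p a * f a = 0.
  under eq_bigr do rewrite mulrBr.
  by rewrite sumrB -mulr_suml p_sum1 mul1r subrr.
transitivity (\sum_(i : 'I_n.+1) \sum_(j : 'I_n.+1) \sum_(y : word)
    weight y * (f (y i) * f (y j))).
  under [RHS]eq_bigr do rewrite exchange_big /=.
  rewrite exchange_big; apply: eq_bigr => y _ /=.
  under [RHS]eq_bigr do rewrite -mulr_sumr -mulr_sumr.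
  rewrite -mulr_sumr -mulr_suml -expr2; congr (_ * _ ^+ 2).
  by rewrite natr_sum sumrB sumr_const card_ord mulr_natl.
transitivity (\sum_(i < n.+1) var); last by rewrite sumr_const card_ord mulr_natl.
apply: eq_bigr => i _; rewrite (bigD1 i) //= [X in _ + X]big1 => [|j ji].
  by rewrite addr0; exact: (weight_coord i (fun a => f a * f a)).
by rewrite weight_coord2 1?eq_sym // Ef expr0n.
Qed.

(** The positive part of a number is at least the number itself. *)
Lemma ballot_mass_ge : 1 - mean <= ballot_mass.
Proof.
rewrite -(@ler_pM2l _ n.+1%:R) ?ltr0n // ballot_massE mulrBr mulr1 -weight_mean.
have -> : n.+1%:R = \sum_(y : word) weight y * n.+1%:R :> R.
  by rewrite -mulr_suml weight_sum1 mul1r.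
rewrite -sumrB; apply: ler_sum => y _.
rewrite -mulrBr ler_wpM2l ?weight_ge0 //.
have [le|/ltnW] := leqP (\sum_i y i) n.+1; first by rewrite natrB.
by rewrite -subn_eq0 => le; rewrite (eqP le) subr_le0 ler_nat -subn_eq0.
Qed.

(** Chebyshev's inequality for the deviation of the sum of the letters from
    its mean.  The error terms vanish as [n] tends to infinity and then [e]
    to 0. *)
Lemma ballot_mass_le e : 0 < e -> mean <= 1 ->
  ballot_mass <= 1 - mean + e + var / (e * n.+1%:R).
Proof.
move=> e0 m1; have n0 : (0 : R) < n.+1%:R by rewrite ltr0n.
rewrite -(@ler_pM2l _ n.+1%:R) // ballot_massE.
have -> : n.+1%:R * (1 - mean + e + var / (e * n.+1%:R)) =
    \sum_(y : word) weight y * (n.+1%:R * (1 - mean + e) +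
      ((\sum_i y i)%:R - n.+1%:R * mean) ^+ 2 / (e * n.+1%:R)).
  under [RHS]eq_bigr do rewrite mulrDr [X in _ + X]mulrA.
  rewrite big_split /= -!mulr_suml weight_sum1 mul1r weight_var.
  by rewrite mulrDr; congr (_ + _); rewrite mulrA.
apply: ler_sum => y _; rewrite ler_wpM2l ?weight_ge0 //.
set s := (\sum_i y i)%N; set N := n.+1%:R.
have q0 : 0 <= (s%:R - N * mean) ^+ 2 / (e * N).
  by rewrite divr_ge0 ?sqr_ge0 // mulr_ge0 // ltW.
have [le|lt] := leqP s n.+1; last first.
  rewrite (_ : (_ - _)%N = 0%N); last by lia.
  by rewrite mulr0n addr_ge0 // mulr_ge0 ?(ltW n0) // addr_ge0 ?subr_ge0 // ltW.
rewrite natrB // -/N.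
(* x <= a + x^2 / a with x = N mean - s and a = e N: Chebyshev pointwise *)
have : N * mean - s%:R <= N * e + (s%:R - N * mean) ^+ 2 / (e * N).
  set u := s%:R - N * mean.
  rewrite -[N * mean - _]opprB -/u -(@ler_pM2r _ (e * N)) ?mulr_gt0 //.
  rewrite mulrDl mulfVK ?mulf_neq0 ?gt_eqF //.
  rewrite [N * e]mulrC; set a := e * N.
  have := sqr_ge0 (u + a / 2); have := sqr_ge0 a; rewrite !expr2.
  lra.
by move: (_ / _) => Q ?; lra.
Qed.
End finite_ballot.

(** * Measurability and countable partitions *)

Section measurability.
Context d (T : measurableType d).

Lemma measurable_preimage d' (T' : measurableType d') (f : T -> T') (A : set T') :
  measurable_fun [set: T] f -> measurable A -> measurable (f @^-1` A).
Proof. by move=> mf mA; rewrite -[_ @^-1` _]setTI; exact: mf. Qed.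

Lemma measurable_forall (D : set nat) (E : nat -> set T) :
  (forall i, D i -> measurable (E i)) ->
  measurable [set w | forall i, D i -> E i w].
Proof.
move=> mE; rewrite (_ : [set w | _] = \bigcap_(i in D) E i); last by [].
exact: bigcap_measurableType.
Qed.

Lemma measurable_random_index d' (T' : measurableType d') (N : T -> nat)
    (F : nat -> T -> T') :
  measurable_fun [set: T] N -> (forall m, measurable_fun [set: T] (F m)) ->
  measurable_fun [set: T] (fun w => F (N w) w).
Proof.
move=> mN mF _ A mA; rewrite setTI.
rewrite (_ : _ @^-1` _ = \bigcup_m (N @^-1` [set m] `&` F m @^-1` A)).
  apply: bigcupT_measurable => m.
  by apply: measurableI; apply: measurable_preimage.
by apply/seteqP; split => w /= => [Aw|[m _ [-> ]]//]; exists (N w).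
Qed.

Lemma measurable_sumn (W : nat -> T -> nat) (n : nat) :
  (forall j, measurable_fun [set: T] (W j)) ->
  measurable_fun [set: T] (fun w => (\sum_(j < n) W j w)%N).
Proof.
move=> mW; elim: n => [|n IH].
  by under eq_fun do rewrite big_ord0; exact: measurable_cst.
by under eq_fun do rewrite big_ord_recr /=; exact: measurable_fun_addn.
Qed.

End measurability.

Section probability_lemmas.
Context d (T : measurableType d) (R : realType) (P : probability T R).
Local Open Scope ereal_scope.

Lemma le_measure_ae (A B : set T) : measurable A -> measurable B ->
  {ae P, forall w, A w -> B w} -> P A <= P B.
Proof.
move=> mA mB [N [mN PN sN]]; rewrite -[leRHS]adde0 -PN.
apply: (@le_trans _ _ (P (B `|` N))); last exact: measureU2.
apply: le_measure; rewrite ?inE //.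
  exact: measurableU.
move=> w Aw; have [Bw|nBw] := pselect (B w); first by left.
by right; apply: sN => /= /(_ Aw).
Qed.

Lemma eq_measure_ae (A B : set T) : measurable A -> measurable B ->
  {ae P, forall w, A w <-> B w} -> P A = P B.
Proof.
move=> mA mB AB; apply/eqP; rewrite eq_le; apply/andP; split.
  by apply: le_measure_ae => //; apply: filterS AB => w [].
by apply: le_measure_ae => //; apply: filterS AB => w [].
Qed.

Lemma measure_partition_nat (V : T -> nat) (A : set T) :
  measurable_fun [set: T] V -> measurable A ->
  P A = \sum_(b <oo) P (A `&` V @^-1` [set b]).
Proof.
move=> mV mA; have -> : \sum_(b <oo) P (A `&` V @^-1` [set b]) =
    \sum_(b <oo | b \in [set: nat]) P (A `&` V @^-1` [set b]).
  by apply: eq_eseriesl => i; rewrite in_setT.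
rewrite -measure_bigcup => [|i _|]; last 2 first.
- by apply: measurableI => //; exact: measurable_preimage.
- by move=> i j _ _ [w [[_ /= <-] [_ /= <-]]].
congr (P _); apply/seteqP; split => [w Aw|w [b _ []//]].
by exists (V w).
Qed.

End probability_lemmas.

Section sigma_generated_closure.
Context d d' (T : measurableType d) (T' : measurableType d').
Variables (I : Type) (D : set I) (X : I -> T -> T').

Lemma sigma_generated_preimage i (B : set T') : D i -> measurable B ->
  sigma_generated D X (X i @^-1` B).
Proof.
move=> Di mB; apply: sub_gen_smallest; exists i => //.
by exists B => //; rewrite setTI.
Qed.

Lemma sigma_generated_forall (J : set nat) (E : nat -> set T) :
  (forall j, J j -> sigma_generated D X (E j)) ->
  sigma_generated D X [set w | forall j, J j -> E j w].
Proof.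
exact: (@measurable_forall _ (g_sigma_algebraType
  (\bigcup_(i in D) preimage_set_system [set: T] (X i) measurable))).
Qed.

End sigma_generated_closure.

(** * Independence of compound increments *)

(** [M i] is the number of claims up to the i-th point of a time grid, and
    [W j] is the size of claim [j], a natural number.  The joint law of
    counts and claims is given only on cylinders, through [joint]; this is
    what the independence assumptions on the model provide directly. *)
Section compound_increments.
Context d (T : measurableType d) (R : realType) (P : probability T R).
Variables (M W : nat -> T -> nat) (pM pW : nat -> R).
Hypothesis mM : forall i, measurable_fun [set: T] (M i).
Hypothesis mW : forall j, measurable_fun [set: T] (W j).
Hypothesis pM_ge0 : forall u, 0 <= pM u.
Hypothesis pW_ge0 : forall b, 0 <= pW b.
Hypothesis pM_sum : (\sum_(u <oo) (pM u)%:E <= 1)%E.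
Hypothesis pW_sum : (\sum_(b <oo) (pW b)%:E <= 1)%E.
Hypothesis M_homo : {ae P, forall w, forall i, (M i w <= M i.+1 w)%N}.

(** The increments of [M] before grid point [size a] are the entries of [a].
    Prescribing the values of [M] instead of its increments avoids truncated
    subtraction and includes [M 0 = 0]. *)
Definition count_cylinder (a : seq nat) : set T :=
  [set w | forall i, (i <= size a)%N -> M i w = sumn (take i a)].

Definition claim_cylinder (z : seq nat) : set T :=
  [set w | forall j, (j < size z)%N -> W j w = nth 0%N z j].

Hypothesis joint : forall a z, P (count_cylinder a `&` claim_cylinder z) =
  (\prod_(u <- a) pM u * \prod_(b <- z) pW b)%:E.

Definition compound i w := (\sum_(j < M i w) W j w)%N.

Lemma measurable_compound i : measurable_fun [set: T] (compound i).
Proof.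
apply: (measurable_random_index (F := fun m w => (\sum_(j < m) W j w)%N)) => // m.
exact: measurable_sumn.
Qed.

Definition increments_from (k : nat) (Bs : seq (set nat)) : set T :=
  [set w | forall i, (i < size Bs)%N ->
    nth setT Bs i (compound (k + i).+1 w - compound (k + i) w)%N].

Let m_count a : measurable (count_cylinder a).
Proof.
apply: (measurable_forall (D := [set i | (i <= size a)%N])
  (E := fun i => M i @^-1` [set sumn (take i a)])) => // i _.
exact: measurable_preimage.
Qed.

Let m_claim z : measurable (claim_cylinder z).
Proof.
apply: (measurable_forall (D := [set i | (i < size z)%N])
  (E := fun i => W i @^-1` [set nth 0%N z i])) => // i _.
exact: measurable_preimage.
Qed.

Let m_increments k Bs : measurable (increments_from k Bs).
Proof.
apply: (measurable_forall (D := [set i | (i < size Bs)%N])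
  (E := fun i => (fun w => (compound (k + i).+1 w - compound (k + i) w)%N) @^-1`
     nth setT Bs i)) => // i _.
apply: measurable_preimage => //.
by apply: measurable_fun_subn; exact: measurable_compound.
Qed.

Let m_block o v s (B : set nat) :
  measurable [set w | B (s + \sum_(j < v) W (o + j) w)%N].
Proof.
apply: (measurable_preimage (f := fun w => (s + \sum_(j < v) W (o + j) w)%N)) => //.
apply: measurable_fun_addn; first exact: measurable_cst.
exact: (measurable_sumn (W := fun j => W (o + j)%N)).
Qed.

Let series_le1 (f g : nat -> R) : (forall b, 0 <= f b) ->
  (forall b, 0 <= g b <= 1) -> (\sum_(b <oo) (f b)%:E <= 1)%E ->
  (\sum_(b <oo) (f b)%:E * (g b)%:E)%E =
  (fine (\sum_(b <oo) (f b)%:E * (g b)%:E)%E)%:E /\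
  0 <= fine (\sum_(b <oo) (f b)%:E * (g b)%:E)%E <= 1.
Proof.
move=> f0 g01 f1.
have ge0 : (0 <= \sum_(b <oo) (f b)%:E * (g b)%:E)%E.
  apply: nneseries_ge0 => b _ _; rewrite mule_ge0 ?lee_fin //.
  by case/andP: (g01 b).
have le1 : (\sum_(b <oo) (f b)%:E * (g b)%:E <= 1)%E.
  apply: le_trans f1; apply: lee_nneseries => b *.
    by rewrite mule_ge0 ?lee_fin //; case/andP: (g01 b).
  by rewrite -[leRHS]mule1 lee_pmul ?lee_fin //; case/andP: (g01 b).
have fin : (\sum_(b <oo) (f b)%:E * (g b)%:E)%E \is a fin_num.
  by rewrite ge0_fin_numE // (le_lt_trans le1) // ltry.
by rewrite fineK //; split => //; rewrite -!lee_fin fineK // ge0 le1.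
Qed.

(** The probability that [s] plus a sum of [v] independent claims lies in
    [B], computed by conditioning on the claims one at a time. *)
Fixpoint claim_sum_law (v s : nat) (B : set nat) : R :=
  if v is v'.+1 then
    fine (\sum_(b <oo) (pW b)%:E * (claim_sum_law v' (s + b) B)%:E)%E
  else \1_B s.

Let claim_sum_law01 v s B : 0 <= claim_sum_law v s B <= 1.
Proof.
elim: v s => [|v IH] s /=; first by rewrite indicE; case: (_ \in _); rewrite /= ?lexx ler01.
by have [] := series_le1 pW_ge0 (fun b => IH (s + b)%N) pW_sum.
Qed.

Let claim_sum_lawS v s B : (claim_sum_law v.+1 s B)%:E =
  (\sum_(b <oo) (pW b)%:E * (claim_sum_law v (s + b) B)%:E)%E.
Proof.
by have [-> _] := series_le1 pW_ge0 (fun b => claim_sum_law01 v (s + b) B) pW_sum.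
Qed.

Definition increment_law (B : set nat) : R :=
  fine (\sum_(u <oo) (pM u)%:E * (claim_sum_law u 0 B)%:E)%E.

Let claim_rcons z b :
  claim_cylinder (rcons z b) = claim_cylinder z `&` W (size z) @^-1` [set b].
Proof.
apply/seteqP; split => [w h|w [h /= hb] j].
  split => [j jz|/=]; last by rewrite h ?size_rcons // nth_rcons ltnn eqxx.
  have jz' : (j < size (rcons z b))%N by rewrite size_rcons ltnS ltnW.
  by rewrite (h j jz') nth_rcons jz.
rewrite size_rcons ltnS leq_eqVlt nth_rcons => /orP[/eqP ->|jz].
  by rewrite ltnn eqxx.
by rewrite jz h.
Qed.

(** Conditioning on the next claim, through the countable partition by its
    value, extends the cylinder by one letter and leaves a sum with one claim
    fewer.  [H] stands for the counts and for all later increments; its joint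
    law with the claims revealed so far is a product once [N] claims are
    revealed. *)
Let reveal_claims (H : set T) (C : R) N B : measurable H -> 0 <= C ->
  (forall z, size z = N ->
     P (H `&` claim_cylinder z) = (C * \prod_(b <- z) pW b)%:E) ->
  forall v s z, (size z + v)%N = N ->
    P (H `&` claim_cylinder z `&`
       [set w | B (s + \sum_(j < v) W (size z + j) w)%N]) =
    (C * \prod_(b <- z) pW b * claim_sum_law v s B)%:E.
Proof.
move=> mH C0 hH; elim=> [|v IH] s z zN.
  rewrite addn0 in zN; rewrite (_ : [set w | _] = [set _ | B s]); last first.
    by apply/funext => w /=; rewrite big_ord0 addn0.
  rewrite /= indicE; have [Bs|nBs] := pselect (B s).
    rewrite mem_set // mulr1 -hH // (_ : [set _ | B s] = setT) ?setIT //.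
    by apply/seteqP; split.
  rewrite memNset // mulr0 (_ : [set _ | B s] = set0) ?setI0 ?measure0 //.
  by apply/seteqP; split.
rewrite (measure_partition_nat P (mW (size z))); last first.
  by apply: measurableI => //; exact: measurableI.
rewrite EFinM claim_sum_lawS -nneseriesZl; last first.
  by move=> b _; rewrite mule_ge0 ?lee_fin //; case/andP: (claim_sum_law01 v (s + b) B).
apply: eq_eseriesr => b _.
have := IH (s + b)%N (rcons z b); rewrite size_rcons addSnnS => /(_ zN).
move=> E.
rewrite -!EFinM.
transitivity (C * \prod_(b0 <- rcons z b) pW b0 * claim_sum_law v (s + b) B)%:E;
  last by congr (_%:E); rewrite big_rcons /=; ring.
rewrite -E; congr (P _); rewrite claim_rcons.
apply/seteqP; split => [w [[[Hw zw] Bw] /= Wb]|w [[Hw [zw /= Wb]] Bw]].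
  split => //=; move: Bw => /=; rewrite big_ord_recl /= addn0 Wb addnA.
  by under eq_bigr do rewrite /bump /= add1n addnS -addSn.
split => //; split => //=; rewrite big_ord_recl /= addn0 Wb addnA.
by under eq_bigr do rewrite /bump /= add1n addnS -addSn.
Qed.

Let compound_step k w u : M k.+1 w = (M k w + u)%N ->
  (compound k.+1 w - compound k w = \sum_(j < u) W (M k w + j) w)%N.
Proof. by rewrite /compound => ->; rewrite big_split_ord /= addKn. Qed.

Let increments_cons k B Bs :
  increments_from k (B :: Bs) =
  [set w | B (compound k.+1 w - compound k w)%N] `&` increments_from k.+1 Bs.
Proof.
apply/seteqP; split => [w h|w [/= hB h] [|i]].
- split => [|i iB]; first by have := h 0%N isT; rewrite addn0.
  by have := h i.+1 iB; rewrite /= addnS addSn.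
- by rewrite addn0.
- by move=> iB; have := h i iB; rewrite /= addnS addSn.
Qed.

Let count_rcons a u w : count_cylinder a w -> M (size a).+1 w = (sumn a + u)%N ->
  count_cylinder (rcons a u) w.
Proof.
move=> ha hu i; rewrite size_rcons leq_eqVlt ltnS => /orP[/eqP ->|ia].
  by rewrite hu -(size_rcons a u) take_size sumn_rcons.
by rewrite ha // -cats1 takel_cat.
Qed.

Let increment_law_mul K B : 0 <= K ->
  (\sum_(u <oo) (K * (pM u * claim_sum_law u 0 B))%:E)%E = (K * increment_law B)%:E.
Proof.
move=> K0; have [E _] := series_le1 pM_ge0 (fun u => claim_sum_law01 u 0 B) pM_sum.
rewrite EFinM /increment_law -E -nneseriesZl => [|u _].
  by apply: eq_eseriesr => u _; rewrite -!EFinM.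
by rewrite mule_ge0 ?lee_fin //; case/andP: (claim_sum_law01 u 0 B).
Qed.

Let increment_law_ge0 B : 0 <= increment_law B.
Proof.
by have [_ /andP[]] := series_le1 pM_ge0 (fun u => claim_sum_law01 u 0 B) pM_sum.
Qed.

(** Conditioning on the next increment of [M] says how many claims belong to
    the next interval.  Once these claims are revealed as well
    ([reveal_claims]), the remaining intervals are governed by the induction
    hypothesis for a longer cylinder. *)
Let reveal_counts Bs a z : size z = sumn a ->
  P (count_cylinder a `&` increments_from (size a) Bs `&` claim_cylinder z) =
  (\prod_(u <- a) pM u * \prod_(b <- z) pW b * \prod_(B <- Bs) increment_law B)%:E.
Proof.
elim: Bs a z => [|B Bs IH] a z za.
  rewrite big_nil mulr1 -joint; congr (P (_ `&` _)).
  by apply/seteqP; split => [w []|w] //.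
pose V w := (M (size a).+1 w - M (size a) w)%N.
have mV : measurable_fun [set: T] V by exact: measurable_fun_subn.
rewrite (measure_partition_nat P mV); last first.
  by apply: measurableI => //; apply: measurableI.
set c := \prod_(u <- a) pM u * \prod_(b <- z) pW b * \prod_(B <- Bs) increment_law B.
have c0 : 0 <= c.
  by rewrite !mulr_ge0 // prodr_ge0.
transitivity (c * increment_law B)%:E;
  last by congr (_%:E); rewrite big_cons /c; ring.
rewrite -increment_law_mul //; apply: eq_eseriesr => u _.
pose H := count_cylinder (rcons a u) `&` increments_from (size a).+1 Bs.
have mH : measurable H by exact: measurableI.
have E := @reveal_claims H ((\prod_(u <- rcons a u) pM u) *
  \prod_(B <- Bs) increment_law B) (size z + u) B mH _ _ u 0%N z erefl.
transitivity (\prod_(i <- rcons a u) pM i * \prod_(i <- Bs) increment_law i *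
  \prod_(i <- z) pW i * claim_sum_law u 0 B)%:E;
  last by congr (_%:E); rewrite big_rcons /= /c; ring.
rewrite -E; last 2 first.
- by rewrite mulr_ge0 // prodr_ge0.
- move=> z' z'N; rewrite /H -(size_rcons a u) IH ?sumn_rcons -?za //.
  by congr (_%:E); ring.
apply: eq_measure_ae.
- apply: measurableI; last exact: measurable_preimage.
  by apply: measurableI => //; exact: measurableI.
- by apply: measurableI; [exact: measurableI|exact: m_block].
apply: filterS M_homo => w homo; split.
  move=> [[[aw incw] zw] /= Vw].
  have Mw : M (size a) w = sumn a by rewrite aw // take_size.
  have MSw : M (size a).+1 w = (sumn a + u)%N by rewrite -Mw -Vw /V subnKC.
  move: incw; rewrite increments_cons => -[/= hB hBs].
  split => //=; first by split => //; split => //; exact: count_rcons.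
  by move: hB; rewrite (@compound_step _ _ u) Mw // za.
move=> [[[aw incw] zw] /= hB].
have Mw : M (size a) w = sumn a.
  by rewrite aw ?size_rcons // -cats1 take_size_cat.
have MSw : M (size a).+1 w = (sumn a + u)%N.
  by rewrite aw ?size_rcons // -(size_rcons a u) take_size sumn_rcons.
split; last by rewrite /= /V MSw Mw addKn.
split => //; split; last first.
  by rewrite increments_cons; split => //=; rewrite (@compound_step _ _ u) Mw // -za.
move=> i ia; have ia' : (i <= size (rcons a u))%N by rewrite size_rcons leqW.
by rewrite (aw i ia') -cats1 takel_cat.
Qed.

(** With nothing revealed, the law of the increments is a product over the
    intervals whose factors do not depend on the interval: the increments are
    independent and identically distributed. *)
Lemma compound_increments_iid Bs :
  P (count_cylinder [::] `&` increments_from 0 Bs) =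
  (\prod_(B <- Bs) increment_law B)%:E.
Proof.
have := @reveal_counts Bs [::] [::] erefl; rewrite !big_nil !mul1r => <-.
by congr (P _); rewrite -[LHS]setIT; congr (_ `&` _); apply/seteqP; split.
Qed.

End compound_increments.

(** * Means of natural-valued random variables *)

Lemma finite_support_series (R : realType) (x : nat -> R) n :
  (forall i, 0 <= x i) ->
  (\sum_(i <oo) (if (i < n)%N then x i else 0)%:E = (\sum_(i < n) x i)%:E)%E.
Proof.
move=> x0; rewrite (nneseries_split 0 n) => [|k _]; last first.
  by case: ifP => // _; rewrite lee_fin.
rewrite add0n eseries0 => [|i ni _]; last by rewrite ltnNge ni.
rewrite adde0 big_mkord -sumEFin; apply: eq_bigr => i _.
by rewrite ltn_ord.
Qed.

Section nat_mean.
Context d (T : measurableType d) (R : realType) (P : probability T R).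
Local Open Scope ereal_scope.
Implicit Types f : T -> nat.

Definition nat_mean f : \bar R := \int[P]_w ((f w)%:R)%:E.

Lemma measurable_natr f : measurable_fun [set: T] f ->
  measurable_fun [set: T] (fun w => ((f w)%:R)%:E : \bar R).
Proof.
move=> mf; apply/measurable_EFinP.
by apply: (measurableT_comp (f := fun n : nat => n%:R : R)).
Qed.

(** A natural number is the sum over all [b] of the indicators of [b < n]. *)
Lemma nat_mean_tail f : measurable_fun [set: T] f ->
  nat_mean f = \sum_(b <oo) P [set w | (b < f w)%N].
Proof.
move=> mf.
have mE b : measurable [set w | (b < f w)%N].
  exact: (measurable_preimage (A := [set n | (b < n)%N])).
transitivity (\int[P]_w (\sum_(b <oo) (\1_[set w | (b < f w)%N] w)%:E)).
  apply: eq_integral => w _.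
  transitivity (\sum_(b <oo) ((if (b < f w)%N then 1%R else 0%R) : R)%:E).
    by rewrite (finite_support_series (x := fun=> 1%R)) // sumr_const card_ord.
  apply: eq_eseriesr => b _; rewrite indicE; case: ifP => h.
    by rewrite mem_set.
  by rewrite memNset //= h.
rewrite integral_nneseries // => [|b].
  by apply: eq_eseriesr => b _; rewrite integral_indic // setIT.
by apply/measurable_EFinP; exact: measurable_indic.
Qed.

Lemma nat_mean_pmf f : measurable_fun [set: T] f ->
  nat_mean f = \sum_(n <oo) (n%:R)%:E * P (f @^-1` [set n]).
Proof.
move=> mf; rewrite nat_mean_tail //.
have mE b : measurable [set w | (b < f w)%N].
  exact: (measurable_preimage (A := [set n | (b < n)%N])).
transitivity (\sum_(b <oo) \sum_(n <oo)
    ((if (b < n)%N then fine (P (f @^-1` [set n])) else 0%R) : R)%:E).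
  apply: eq_eseriesr => b _; rewrite (measure_partition_nat P mf) //.
  apply: eq_eseriesr => n _; case: ifP => bn.
    rewrite fineK ?fin_num_measure //; last exact: measurable_preimage.
    by congr (P _); apply/seteqP; split => [w []//|w /= fw]; rewrite fw.
  rewrite (_ : _ `&` _ = set0) ?measure0 //.
  by apply/seteqP; split => // w [/= + fw]; rewrite fw bn.
rewrite nneseries_interchange => [|b n]; last first.
  by rewrite lee_fin; case: ifP => // _; rewrite fine_ge0.
apply: eq_eseriesr => n _.
rewrite (finite_support_series (x := fun=> fine (P (f @^-1` [set n])))) => [|_].
  rewrite sumr_const card_ord -[(fine _ *+ n)%R]mulr_natl EFinM fineK ?fin_num_measure //.
  exact: measurable_preimage.
by rewrite fine_ge0.
Qed.

(** A random sum is the sum over all [i] of [X i] on the event [i < N].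
    Independence, applied to the events of the tail formula, turns the mean of
    each term into [P (i < N)] times the mean of [X 0]. *)
Lemma wald (N : T -> nat) (X : nat -> T -> nat) (m : R) :
  measurable_fun [set: T] N -> (forall i, measurable_fun [set: T] (X i)) ->
  (forall i b, P ([set w | (b < X i w)%N] `&` [set w | (i < N w)%N]) =
     P [set w | (b < X 0%N w)%N] * P [set w | (i < N w)%N]) ->
  nat_mean (X 0%N) = m%:E ->
  nat_mean (fun w => (\sum_(i < N w) X i w)%N) = m%:E * nat_mean N.
Proof.
move=> mN mX indep Xm.
pose g i w := if (i < N w)%N then X i w else 0%N.
have mltN i : measurable [set w | (i < N w)%N].
  exact: (measurable_preimage (A := [set n | (i < n)%N])).
have mltX i b : measurable [set w | (b < X i w)%N].
  exact: (measurable_preimage (A := [set n | (b < n)%N])).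
have mg i : measurable_fun [set: T] (g i).
  apply: (measurable_random_index
    (F := fun n w => if (i < n)%N then X i w else 0%N)) => // n.
  by case: (i < n)%N => //; exact: measurable_cst.
transitivity (\int[P]_w \sum_(i <oo) ((g i w)%:R)%:E).
  apply: eq_integral => w _; rewrite natr_sum.
  rewrite -(finite_support_series (x := fun i => (X i w)%:R)) //.
  by apply: eq_eseriesr => i _; rewrite /g; case: ifP.
rewrite integral_nneseries //; last by move=> i; exact: measurable_natr.
rewrite (nat_mean_tail mN) -nneseriesZl //; apply: eq_eseriesr => i _.
rewrite -/(nat_mean (g i)) nat_mean_tail //.
transitivity (\sum_(b <oo) P [set w | (i < N w)%N] * P [set w | (b < X 0%N w)%N]).
  apply: eq_eseriesr => b _; rewrite muleC -indep; congr (P _).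
  apply/seteqP; split => w; rewrite /= /g; last by case=> + ->.
  by case: ifP.
rewrite -[P [set w | _]]fineK ?fin_num_measure // nneseriesZl //.
by rewrite -nat_mean_tail // Xm muleC.
Qed.

End nat_mean.

(** The identity [n * pmf n = x * pmf (n - 1)] shifts the series of the mean
    to the series of the total mass. *)
Lemma poisson_mean d (T : measurableType d) (R : realType) (P : probability T R)
    (x : R) (N : T -> nat) : 0 < x -> measurable_fun [set: T] N ->
  (forall n, P (N @^-1` [set n]) = (poisson_pmf x n)%:E) ->
  nat_mean P N = x%:E.
Proof.
move=> x0 mN pmfN; rewrite nat_mean_pmf //.
under eq_eseriesr do rewrite pmfN -EFinM.
have ge0 n : (0 <= (n%:R * poisson_pmf x n)%:E)%E.
  by rewrite lee_fin mulr_ge0 // poisson_pmf_ge0.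
rewrite nneseries_recl // mul0r add0e.
rewrite -(nneseries_addn (f := fun n => (n%:R * poisson_pmf x n)%:E)) //.
transitivity (\sum_(n <oo) x%:E * (poisson_pmf x n)%:E)%E.
  apply: eq_eseriesr => n _; rewrite addn1 -EFinM /poisson_pmf x0; congr (_%:E).
  rewrite factS exprS natrM; field.
  by rewrite pnatr_eq0 -lt0n fact_gt0 addrC natr1 pnatr_eq0.
rewrite nneseriesZl => [|n _]; last by rewrite lee_fin poisson_pmf_ge0.
under eq_eseriesr do rewrite -pmfN.
have := measure_partition_nat P mN (@measurableT _ T).
by under eq_eseriesr do rewrite setTI; rewrite probability_setT => <-; rewrite mule1.
Qed.

Section counting_process_mean.
Context d (T : measurableType d) (R : realType) (P : probability T R).
Variables (k : nat) (lam : 'I_k -> R) (M : R -> T -> nat).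
Hypothesis k_gt0 : (0 < k)%N.
Hypothesis lam_gt0 : forall j, 0 < lam j.
Hypothesis mM : forall t, measurable_fun [set: T] (M t).
Hypothesis hM : generalized_counting_process P lam M.

Let rate_gt0 : 0 < \sum_(j < k) lam j.
Proof.
rewrite (bigD1 (Ordinal k_gt0)) //= ltr_pwDl //.
by apply: sumr_ge0 => j _; exact: ltW.
Qed.

(** The given masses add up to 1, so that all other values of [X] have
    probability 0. *)
Let jump_mean d' (T' : measurableType d') (Q : probability T' R) (X : T' -> nat) :
  measurable_fun [set: T'] X ->
  (forall j : 'I_k, Q (X @^-1` [set j.+1]) = (lam j / \sum_(i < k) lam i)%:E) ->
  nat_mean Q X = ((\sum_(j < k) j.+1%:R * lam j) / \sum_(i < k) lam i)%:E.
Proof.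
move=> mX hX; rewrite nat_mean_pmf //.
have mp n : measurable (X @^-1` [set n]) by exact: measurable_preimage.
have tot : Q (X @^-1` [set n | (1 <= n <= k)%N]) = 1%E.
  rewrite (_ : X @^-1` _ = \big[setU/set0]_(j < k) X @^-1` [set j.+1]).
    rewrite measure_bigsetU_ord //; last first.
      by move=> i j _ _ [w [/= -> /eqP]]; rewrite eqSS => /eqP /val_inj.
    rewrite (eq_bigr (fun j => (lam j / \sum_(i < k) lam i)%:E)) => [|j _]; last exact: hX.
    by rewrite sumEFin -mulr_suml mulfV // gt_eqF.
  rewrite -(bigcup_mkord k (fun j => X @^-1` [set j.+1])).
  apply/seteqP; split => [w /= /andP[X1 Xk]|w [j /= jk ->]//].
  by exists (X w).-1; rewrite /= prednK.
have out n : ~~ (1 <= n <= k)%N -> Q (X @^-1` [set n]) = 0%E.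
  move=> hn; apply/eqP; rewrite eq_le measure_ge0 andbT.
  have <- : Q (~` (X @^-1` [set n | (1 <= n <= k)%N])) = 0%E.
    by rewrite probability_setC ?tot ?subee //; exact: measurable_preimage.
  apply: le_measure; rewrite ?inE //; first by apply: measurableC; exact: measurable_preimage.
  by move=> w /= ->; exact/negP.
transitivity (\sum_(n <oo) (if (n < k.+1)%N then n%:R * fine (Q (X @^-1` [set n])) else 0)%:E)%E.
  apply: eq_eseriesr => n _; case: ifP => nk.
    by rewrite EFinM fineK // fin_num_measure.
  by rewrite out ?mule0 // -[(n <= k)%N]ltnS nk andbF.
rewrite (finite_support_series (x := fun n => n%:R * fine (Q (X @^-1` [set n])))) => [|n].
  rewrite big_ord_recl mul0r add0r mulr_suml; congr (_%:E).
  by apply: eq_bigr => j _; rewrite hX /= mulrA.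
by rewrite mulr_ge0 // fine_ge0.
Qed.

(** The mean depends on the law only, so it is computed on the space of the
    compound Poisson representation. *)
Lemma counting_process_mean (t : R) : 0 < t ->
  nat_mean P (M t) = (t * \sum_(j < k) j.+1%:R * lam j)%:E.
Proof.
move=> t0; have t0' := ltW t0.
have [_ [d' [T' [Q [N [X [hN hX hX0 hNX hlaw]]]]]]] := hM.
pose S w := (\sum_(i < N t w) X i w)%N.
have mS : measurable_fun [set: T'] S.
  apply: (measurable_random_index (F := fun n w => (\sum_(i < n) X i w)%N)) => // n.
  by apply: (measurable_sumn (W := fun i => X i)).
have -> : nat_mean P (M t) = nat_mean Q S.
  rewrite !nat_mean_tail //; apply: eq_eseriesr => b _.
  exact: (hlaw t t0' [set n | (b < n)%N]).
have Nm : nat_mean Q (N t) = ((\sum_(j < k) lam j) * t)%:E.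
  apply: poisson_mean => //; first by rewrite mulr_gt0.
  by move=> n; rewrite hN.2.
rewrite (wald (X := fun i => X i) (m := (\sum_(j < k) j.+1%:R * lam j) / \sum_(i < k) lam i)) //.
- by rewrite Nm -EFinM; congr (_%:E); field; rewrite gt_eqF.
- move=> i b; rewrite setIC muleC.
  rewrite (hX.2 0%N i [set n | (b < n)%N]) //.
  apply: hNX.
    exact: (sigma_generated_preimage (i := t) (B := [set n | (i < n)%N])).
  exact: (sigma_generated_preimage (i := i) (B := [set n | (b < n)%N])).
- exact: jump_mean.
Qed.

End counting_process_mean.

(** * Ballot probabilities for independent increments *)

Lemma measure_partition_fin d (T : measurableType d) (R : realType)
    (P : probability T R) (I : finType) (V : T -> I) (A : set T) :
  (forall i, measurable (V @^-1` [set i])) -> measurable A ->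
  P A = (\sum_i fine (P (A `&` V @^-1` [set i])))%:E.
Proof.
move=> mV mA; pose rank w : nat := enum_rank (V w).
have rank_preimage i : rank @^-1` [set (enum_rank i : nat)] = V @^-1` [set i].
  apply/seteqP; split => w /=; last by rewrite /rank => ->.
  by move=> /val_inj /enum_rank_inj.
have mrank : measurable_fun [set: T] rank.
  move=> _ B _; rewrite setTI.
  rewrite (_ : rank @^-1` B =
      \bigcup_(n in B) rank @^-1` [set n]); last first.
    apply/seteqP; split => [w Bw|w [n Bn /= rw]]; first by exists (rank w).
    by rewrite /= rw.
  apply: bigcup_measurable => n _; have [nI|nI] := ltnP n #|I|.
    rewrite (_ : [set n] = [set (enum_rank (enum_val (Ordinal nI)) : nat)]).
      by rewrite rank_preimage.
    by rewrite enum_valK.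
  rewrite (_ : _ @^-1` _ = set0) //; apply/seteqP; split => // w /= rw.
  by have := ltn_ord (enum_rank (V w)); rewrite -/(rank w) rw ltnNge nI.
rewrite (measure_partition_nat P mrank mA).
have mAr n : measurable (A `&` rank @^-1` [set n]).
  by apply: measurableI => //; exact: measurable_preimage.
transitivity (\sum_(n <oo) (if (n < #|I|)%N then
    fine (P (A `&` rank @^-1` [set n])) else 0)%:E)%E.
  apply: eq_eseriesr => n _; case: ltnP => nI.
    by rewrite fineK // fin_num_measure.
  rewrite (_ : _ `&` _ = set0) ?measure0 //.
  apply/seteqP; split => // w [_ /= rw].
  by have := ltn_ord (enum_rank (V w)); rewrite -/(rank w) rw ltnNge nI.
rewrite (finite_support_series (x := fun n => fine (P (A `&` rank @^-1` [set n])))) => [|n].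
  congr (_%:E); rewrite (reindex (@enum_rank I)) /=.
    by apply: eq_bigr => i _; rewrite rank_preimage.
  by apply: onW_bij; exact: enum_rank_bij.
by rewrite fine_ge0.
Qed.

Lemma measurable_ballot d (T : measurableType d) (X : nat -> T -> nat) (n : nat) :
  (forall i, measurable_fun [set: T] (X i)) ->
  measurable [set w | ballot n (fun l => X l w)].
Proof.
move=> mX; rewrite (_ : [set w | _] =
    [set w | forall m, (m < n)%N -> (\sum_(l < m.+1) X l w < m.+1)%N]).
  apply: (measurable_forall (D := [set m | (m < n)%N]) (E := fun m =>
    (fun w => (\sum_(l < m.+1) X l w)%N) @^-1` [set s | (s < m.+1)%N])) => m _.
  by apply: measurable_preimage => //; exact: measurable_sumn.
by apply/seteqP; split => w; [move/ballotP|move=> h; apply/ballotP].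
Qed.

Section iid_ballot.
Context d (T : measurableType d) (R : realType) (P : probability T R).
Variable Y : nat -> T -> nat.
Hypothesis mY : forall i, measurable_fun [set: T] (Y i).
Hypothesis iidY : forall Bs : seq (set nat),
  P [set w | forall i, (i < size Bs)%N -> nth setT Bs i (Y i w)] =
  (\prod_(B <- Bs) fine (P (Y 0%N @^-1` B)))%:E.

(** Capping makes the alphabet finite.  It is harmless for lower bounds on
    ballot probabilities if the cap exceeds the length of the word, and it can
    only increase them. *)
Definition capped (L i : nat) (w : T) : nat := minn (Y i w) L.

Definition capped_law L (a : 'I_L.+1) : R := fine (P (capped L 0 @^-1` [set a : nat])).

Let m_capped L i : measurable_fun [set: T] (capped L i).
Proof.
apply: (@measurableT_comp _ _ _ _ _ _ (fun n => minn n L)) => //.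
Qed.

Let capped_law_ge0 L a : 0 <= capped_law (L := L) a.
Proof. by rewrite /capped_law fine_ge0. Qed.

Let capped_inord L i w : (inord (capped L i w) : 'I_L.+1) = capped L i w :> nat.
Proof. by rewrite inordK // ltnS geq_minr. Qed.

Let capped_law_sum1 L : \sum_a capped_law (L := L) a = 1.
Proof.
pose V w : 'I_L.+1 := inord (capped L 0 w).
have VE a : V @^-1` [set a] = capped L 0 @^-1` [set a : nat].
  apply/seteqP; split => w; rewrite /V /=; first by move=> <-; rewrite capped_inord.
  by move=> wa; apply: val_inj; rewrite /= capped_inord.
have mV a : measurable (V @^-1` [set a]).
  by rewrite VE; exact: measurable_preimage.
have := measure_partition_fin P mV (@measurableT _ T).
rewrite probability_setT => -[->]; apply: eq_bigr => a _.
by rewrite setTI VE.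
Qed.

Let capped_law_mean L :
  (\sum_a capped_law (L := L) a * a%:R)%:E = nat_mean P (capped L 0).
Proof.
rewrite nat_mean_pmf //.
transitivity (\sum_(n <oo) (if (n < L.+1)%N then
    fine (P (capped L 0 @^-1` [set n])) * n%:R else 0)%:E)%E.
  rewrite (finite_support_series
    (x := fun n => fine (P (capped L 0 @^-1` [set n])) * n%:R)) // => n.
  by rewrite mulr_ge0 // fine_ge0.
apply: eq_eseriesr => n _; case: ltnP => nL.
  rewrite muleC EFinM fineK // fin_num_measure //; exact: measurable_preimage.
rewrite (_ : _ @^-1` _ = set0) ?measure0 ?mule0 //.
by apply/seteqP; split => // w /= cw; move: nL; rewrite -cw ltnNge geq_minr.
Qed.

Let ballot_event (n : nat) (X : nat -> T -> nat) : set T :=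
  [set w | ballot n (fun l => X l w)].

Lemma ballot_capped_prob L n :
  P (ballot_event n.+1 (capped L)) = (ballot_mass n (@capped_law L))%:E.
Proof.
pose V w : {ffun 'I_n.+1 -> 'I_L.+1} := [ffun i => inord (capped L (i : 'I_n.+1) w)].
pose Bs (y : {ffun 'I_n.+1 -> 'I_L.+1}) : seq (set nat) :=
  mkseq (fun i => [set v | minn v L = cyclic_ext y i]) n.+1.
have ext_ord (y : {ffun 'I_n.+1 -> 'I_L.+1}) (i : 'I_n.+1) :
    cyclic_ext y i = y i by rewrite /cyclic_ext valZpK.
have VE y : V @^-1` [set y] =
    [set w | forall i, (i < size (Bs y))%N -> nth setT (Bs y) i (Y i w)].
  rewrite size_mkseq; apply/seteqP; split => w /=.
    move=> <- i iN; rewrite nth_mkseq //= (ext_ord _ (Ordinal iN)) ffunE.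
    by rewrite capped_inord.
  move=> h; apply/ffunP => i; apply: val_inj; rewrite ffunE /= capped_inord.
  by have := h i (ltn_ord i); rewrite nth_mkseq //= ext_ord.
have mV y : measurable (V @^-1` [set y]).
  rewrite VE; apply: (measurable_forall (D := [set i | (i < size (Bs y))%N])
    (E := fun i => Y i @^-1` nth setT (Bs y) i)) => i _.
  exact: measurable_preimage.
rewrite (measure_partition_fin P mV); last exact: measurable_ballot.
congr (_%:E); apply: eq_bigr => y _.
have VyE w : V w = y -> forall l : nat, (l < n.+1)%N -> capped L l w = cyclic_ext y l.
  by move=> <- l ln; rewrite (ext_ord _ (Ordinal ln)) ffunE capped_inord.
have ballotE w : V w = y ->
    ballot n.+1 (fun l => capped L l w) = ballot n.+1 (cyclic_ext y).
  move=> /VyE Vy; apply: eq_forallb => m; congr (_ < _)%N.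
  by apply: eq_bigr => l _; rewrite Vy // (leq_trans (ltn_ord l)).
case: (boolP (ballot _ (cyclic_ext y))) => yb; last first.
  rewrite mulr0 (_ : _ `&` _ = set0) ?measure0 //.
  by apply/seteqP; split => // w [/= wb /ballotE E]; move: yb; rewrite -E wb.
rewrite mulr1 (_ : _ `&` _ = V @^-1` [set y]); last first.
  by apply/seteqP; split => [w []//|w /= wy]; split => //=; rewrite /ballot_event /= ballotE.
rewrite VE iidY /Bs /mkseq big_map -[iota 0 n.+1]/(index_iota 0 n.+1) big_mkord /=.
by apply: eq_bigr => i _; rewrite ext_ord.
Qed.

(** Letters of a ballot word are smaller than its length, so that a cap at
    the length does not change the event. *)
Lemma ballot_prob_ge (m : R) n : nat_mean P (Y 0%N) = m%:E ->
  ((1 - m)%:E <= P [set w | ballot n.+1 (fun l => Y l w)])%E.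
Proof.
move=> Ym.
have -> : [set w | ballot n.+1 (fun l => Y l w)] = ballot_event n.+1 (capped n.+1).
  apply/seteqP; split => w /= /ballotP wb; apply/ballotP => k kn.
    by apply: leq_ltn_trans (wb k kn); apply: leq_sum => l _; exact: geq_minl.
  (* a letter n + 1 is excluded from a ballot word of length n + 1 *)
  have small l : (l < n.+1)%N -> capped n.+1 l w = Y l w.
    move=> ln; have := wb l ln; rewrite big_ord_recr /= => h.
    have : (capped n.+1 l w < n.+1)%N.
      by apply: leq_ltn_trans (leq_addl _ _) (leq_trans h ln).
    by rewrite /capped gtn_min ltnn orbF => /ltnW /minn_idPl.
  have := wb k kn; congr (_ < _)%N; apply: eq_bigr => l _.
  by rewrite small // (leq_trans (ltn_ord l)).
rewrite ballot_capped_prob lee_fin.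
apply: (le_trans _ (ballot_mass_ge n (@capped_law_ge0 n.+1) (capped_law_sum1 n.+1))).
rewrite lerD2l lerN2 -lee_fin capped_law_mean -Ym.
apply: ge0_le_integral => //; do ?[exact: measurable_natr].
by move=> w _; rewrite lee_fin ler_nat geq_minl.
Qed.

(** With a cap [L], Chebyshev's inequality bounds the probability by 1 minus
    the capped mean, by letting the length tend to infinity.  The capped mean
    is at least a partial sum of the tail formula and thus tends to [m] as [L]
    tends to infinity. *)
Lemma ballot_prob_le (m : R) (A : set T) : nat_mean P (Y 0%N) = m%:E -> m <= 1 ->
  measurable A ->
  (forall n, {ae P, forall w, A w -> ballot n.+1 (fun l => Y l w)}) ->
  (P A <= (1 - m)%:E)%E.
Proof.
move=> Ym m1 mA hA.
have PA_fin : P A \is a fin_num by rewrite fin_num_measure.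
have capped_le_m L : \sum_a capped_law (L := L) a * a%:R <= m.
  rewrite -lee_fin capped_law_mean -Ym; apply: ge0_le_integral => //;
    do ?[exact: measurable_natr].
  by move=> w _; rewrite lee_fin ler_nat geq_minl.
have bound L : fine (P A) <= 1 - \sum_a capped_law (L := L) a * a%:R.
  set mL := \sum_a _; apply/ler_addgt0Pr => e e0.
  pose V := \sum_a capped_law (L := L) a * (a%:R - mL) ^+ 2.
  have V0 : 0 <= V by apply: sumr_ge0 => a _; rewrite mulr_ge0 ?sqr_ge0.
  (* a length for which the variance term is at most e / 2 *)
  pose n := Num.truncn (V / (e / 2) ^+ 2).
  have e20 : 0 < e / 2 by rewrite divr_gt0.
  have : (P A <= P (ballot_event n.+1 (capped L)))%E.
    apply: le_measure_ae => //; first exact: measurable_ballot.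
    apply: filterS (hA n) => w h /h /ballotP wb; apply/ballotP => k kn.
    by apply: leq_ltn_trans (wb k kn); apply: leq_sum => l _; exact: geq_minl.
  rewrite ballot_capped_prob -[P A]fineK // lee_fin => /le_trans; apply.
  have mL1 : mL <= 1 by apply: le_trans m1; exact: capped_le_m.
  apply: le_trans (ballot_mass_le n (@capped_law_ge0 L) (capped_law_sum1 L) e20 mL1) _.
  rewrite -/mL -/V -addrA lerD2l [leRHS]splitr lerD2l.
  rewrite ler_pdivrMr ?mulr_gt0 // mulrA -expr2.
  by rewrite mulrC -ler_pdivrMr ?exprn_gt0 // ltW // truncnS_gt.
rewrite -[P A]fineK // lee_fin lerBrDl -lerBrDr -lee_fin -Ym nat_mean_tail //.
apply: lime_le.
  by apply: is_cvg_nneseries => b _ _.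
apply: nearW => L.
have := bound L; rewrite lerBrDl -lerBrDr -lee_fin capped_law_mean => /(le_trans _); apply.
rewrite nat_mean_tail //; apply: le_trans (nneseries_lim_ge L _) => //.
rewrite !big_mkord; apply: lee_sum => b _; apply: le_measure; rewrite ?inE.
- exact: (measurable_preimage (A := [set n | (b < n)%N])).
- exact: (measurable_preimage (A := [set n | (b < n)%N])).
- by move=> w /= bw; rewrite /capped leq_min bw ltn_ord.
Qed.

End iid_ballot.

(** * Discretised claims *)

Lemma measurable_truncn (R : realType) :
  measurable_fun [set: R] (@Num.truncn R).
Proof.
have mle n : measurable [set x : R | (Num.truncn x <= n)%N].
  rewrite (_ : [set x | _] = `]-oo, n.+1%:R[%classic) //.
  by apply/seteqP; split => x /=; rewrite in_itv /= truncn_le_nat.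
move=> _ B _; rewrite setTI.
rewrite (_ : _ @^-1` B = \bigcup_(n in B) @Num.truncn R @^-1` [set n]); last first.
  by apply/seteqP; split => [x Bx|x [n Bn /= xn]]; [exists (Num.truncn x)|rewrite /= xn].
apply: bigcup_measurable => -[|n] _.
  rewrite (_ : _ @^-1` _ = [set x : R | (Num.truncn x <= 0)%N]) //.
  by apply/seteqP; split => x /=; [move=> ->|rewrite leqn0 => /eqP].
rewrite (_ : _ @^-1` _ = [set x : R | (Num.truncn x <= n.+1)%N] `\`
    [set x : R | (Num.truncn x <= n)%N]); first exact: measurableD.
apply/seteqP; split => x /= => [->|[h /negP]]; first by rewrite ltnn.
by rewrite -ltnNge => h'; apply/eqP; rewrite eqn_leq h h'.
Qed.

(** The claims are discretised by [phi] and the process is observed at the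
    multiples of [h].  The two roundings, up and down, are instances of
    [phi]. *)
Section discretized_claims.
Context (R : realType) d (T : measurableType d) (P : probability T R).
Variables (k : nat) (lam : 'I_k -> R) (M : R -> {RV P >-> nat}) (Z : nat -> {RV P >-> R}).
Hypothesis hk : (1 <= k)%N.
Hypothesis hlam : forall j, 0 < lam j.
Hypothesis hM : generalized_counting_process P lam (fun t => M t).
Hypothesis hZiid : iid P (fun j => Z j).
Hypothesis hZM : independent_families P [set: nat] (fun j => Z j)
             [set t : R | 0 <= t] (fun t => M t).
Variables (phi : R -> nat) (h : R).
Hypothesis mphi : measurable_fun [set: R] phi.
Hypothesis h_gt0 : 0 < h.

Let W j w := phi (Z j w).
Let Mgrid (i : nat) w := M (i%:R * h) w.
Let pM u := fine (P (M h @^-1` [set u])).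
Let pW b := fine (P (W 0%N @^-1` [set b])).
Let levyM := hM.1.

Let mW j : measurable_fun [set: T] (W j).
Proof. exact: (measurableT_comp mphi). Qed.

Let mMgrid i : measurable_fun [set: T] (Mgrid i).
Proof. by []. Qed.

Let grid_ge0 i : 0 <= i%:R * h.
Proof. by rewrite mulr_ge0 // ltW. Qed.

Let pmf_series (f : T -> nat) : measurable_fun [set: T] f ->
  (\sum_(u <oo) (fine (P (f @^-1` [set u])))%:E <= 1)%E.
Proof.
move=> mf; rewrite -[leRHS](probability_setT P) (measure_partition_nat P mf) //.
apply: lee_nneseries => u *; first by rewrite lee_fin fine_ge0.
by rewrite setTI fineK // fin_num_measure //; exact: measurable_preimage.
Qed.

Let incr_law i (B : set R) : measurable B ->
  P ((fun w => (M (i.+1%:R * h) w)%:R - (M (i%:R * h) w)%:R) @^-1` B) =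
  P ((fun w => (M h w)%:R : R) @^-1` B).
Proof.
move=> mB; have [_ _ _ stat _] := levyM.
rewrite stat // ?ler_wpM2r ?ler_nat //; last exact: ltW.
by rewrite -mulrBl -natrB // subSnn mul1r.
Qed.

Let Mgrid0 : {ae P, forall w, Mgrid 0 w = 0%N}.
Proof.
have [_ + _ _ _] := levyM; apply: filterS => w; rewrite /Mgrid mul0r => /eqP.
by rewrite pnatr_eq0 => /eqP.
Qed.

(** The increments of [M] have the law of values of [M], which are natural
    numbers. *)
Let Mgrid_homo : {ae P, forall w, forall i, (Mgrid i w <= Mgrid i.+1 w)%N}.
Proof.
apply: ae_foralln => i.
pose D w : R := (M (i.+1%:R * h) w)%:R - (M (i%:R * h) w)%:R.
exists (D @^-1` `]-oo, 0[%classic); split.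
- apply: measurable_preimage => //.
  by apply: measurable_funB; apply/measurable_EFinP; exact: measurable_natr.
- rewrite [LHS](incr_law i (measurable_itv _)) (_ : _ @^-1` _ = set0) ?measure0 //.
  by apply/seteqP; split => // w /=; rewrite in_itv /= ltNge ler0n.
- move=> w /= /negP; rewrite -ltnNge in_itv /= /D subr_lt0 ltr_nat; exact.
Qed.

Let claim_prob z : P (claim_cylinder W z) = (\prod_(b <- z) pW b)%:E.
Proof.
pose B i := phi @^-1` [set nth 0%N z i].
have mB i : measurable (B i) by exact: measurable_preimage.
have := hZiid.1 (iota 0 (size z)) B (iota_uniq _ _) mB.
rewrite (_ : \bigcap_(i in _) _ = claim_cylinder W z); last first.
  apply/seteqP; split => w /= hw i; first by move=> iz; apply: hw; rewrite /= mem_iota.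
  by rewrite /= mem_iota => /hw.
move=> ->; rewrite -{1}[size z]subn0 -/(index_iota 0 (size z)).
transitivity (\prod_(0 <= i < size z) (pW (nth 0%N z i))%:E)%E.
  apply: eq_bigr => i _; rewrite /pW fineK; first exact: (hZiid.2 i 0%N _ (mB i)).
  by rewrite fin_num_measure //; exact: measurable_preimage.
by rewrite prodEFin [in RHS](big_nth 0%N).
Qed.

Let count_prob a : P (count_cylinder Mgrid a) = (\prod_(u <- a) pM u)%:E.
Proof.
have [_ _ indep _ _] := levyM.
pose t (i : nat) := i%:R * h.
have t_homo : {homo t : i j / (i <= j)%N >-> i <= j}.
  by move=> i j ij; rewrite ler_wpM2r ?ler_nat // ltW.
pose B i : set R := [set (nth 0%N a i)%:R].
have mB i : measurable (B i) by exact: measurable_set1.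
have := indep t (grid_ge0 0) t_homo (iota 0 (size a)) B (iota_uniq _ _) mB.
set C := \bigcap_(i in _) _ => PC.
have mD i : measurable_fun [set: T]
    (fun w => (M (t i.+1) w)%:R - (M (t i) w)%:R : R).
  by apply: measurable_funB; apply/measurable_EFinP; exact: measurable_natr.
rewrite (_ : P (count_cylinder _ _) = P C).
  rewrite PC -{1}[size a]subn0 -/(index_iota 0 (size a)).
  transitivity (\prod_(0 <= i < size a) (pM (nth 0%N a i))%:E)%E.
    apply: eq_bigr => i _; rewrite [LHS](incr_law i (mB i)) /pM fineK.
      congr (P _); apply/seteqP; split => w /=; rewrite /B /=; last by move=> ->.
      by move/eqP; rewrite eqr_nat => /eqP.
    by rewrite fin_num_measure //; exact: measurable_preimage.
  by rewrite prodEFin [in RHS](big_nth 0%N).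
apply: eq_measure_ae.
- apply: (measurable_forall (D := [set i | (i <= size a)%N])
    (E := fun i => Mgrid i @^-1` [set sumn (take i a)])) => // i _.
  exact: measurable_preimage.
- by apply: bigcap_measurableType => i _; exact: measurable_preimage.
apply: filterS Mgrid0 => w w0; split.
  move=> cw i; rewrite /= mem_iota /= => ia; rewrite /B /=.
  have := cw i (ltnW ia); have := cw i.+1 ia; rewrite /Mgrid -!/(t _) => -> ->.
  by rewrite (take_nth 0%N ia) sumn_rcons natrD addrC addKr.
move=> cw; elim => [|i IH] ia; first by rewrite w0 take0.
have := cw i; rewrite /= mem_iota /= => /(_ ia).
have := IH (ltnW ia); rewrite /B /= /Mgrid -!/(t _) => -> /eqP.
rewrite subr_eq -natrD eqr_nat => /eqP ->.
by rewrite (take_nth 0%N ia) sumn_rcons addnC.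
Qed.

Let joint a z : P (count_cylinder Mgrid a `&` claim_cylinder W z) =
  (\prod_(u <- a) pM u * \prod_(b <- z) pW b)%:E.
Proof.
rewrite setIC hZM ?claim_prob ?count_prob -?EFinM 1?mulrC //.
- apply: (sigma_generated_forall (J := [set j | (j < size z)%N])
    (E := fun j => W j @^-1` [set nth 0%N z j])) => j _.
  apply: (sigma_generated_preimage (i := j) (B := phi @^-1` [set nth 0%N z j])) => //.
  exact: measurable_preimage.
- apply: (sigma_generated_forall (J := [set i | (i <= size a)%N])
    (E := fun i => Mgrid i @^-1` [set sumn (take i a)])) => i _.
  apply: (sigma_generated_preimage (i := i%:R * h)
    (X := fun t => M t) (B := [set sumn (take i a)])) => //.
  exact: grid_ge0.
Qed.

Let S i w := (\sum_(j < Mgrid i w) W j w)%N.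
Let Y i w := (S i.+1 w - S i w)%N.

Let mS i : measurable_fun [set: T] (S i).
Proof. exact: measurable_compound. Qed.

Let mY i : measurable_fun [set: T] (Y i).
Proof. exact: measurable_fun_subn. Qed.

Let iidY (Bs : seq (set nat)) :
  P [set w | forall i, (i < size Bs)%N -> nth setT Bs i (Y i w)] =
  (\prod_(B <- Bs) fine (P (Y 0%N @^-1` B)))%:E.
Proof.
pose G B := increment_law pM pW B.
have cyl Bs' : P [set w | forall i, (i < size Bs')%N -> nth setT Bs' i (Y i w)] =
    (\prod_(B <- Bs') G B)%:E.
  have pM0 u : 0 <= pM u by rewrite /pM fine_ge0.
  have pW0 b : 0 <= pW b by rewrite /pW fine_ge0.
  have pM1 : (\sum_(u <oo) (pM u)%:E <= 1)%E by exact: (pmf_series (f := M h)).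
  have pW1 : (\sum_(b <oo) (pW b)%:E <= 1)%E by exact: pmf_series.
  rewrite -(compound_increments_iid mMgrid mW pM0 pW0 pM1 pW1 Mgrid_homo joint).
  have mI : measurable [set w | forall i, (i < size Bs')%N -> nth setT Bs' i (Y i w)].
    apply: (measurable_forall (D := [set i | (i < size Bs')%N])
      (E := fun i => Y i @^-1` nth setT Bs' i)) => i _.
    exact: measurable_preimage.
  apply: eq_measure_ae => //.
    apply: measurableI => //.
    apply: (measurable_forall (D := [set i | (i <= 0)%N])
      (E := fun i => Mgrid i @^-1` [set sumn (take i [::])])) => i _.
    exact: measurable_preimage.
  apply: filterS Mgrid0 => w w0; split => [hw|[_ hw]]; last exact: hw.
  by split; [case|exact: hw].
rewrite cyl; congr (_%:E); apply: eq_bigr => B _.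
have := cyl [:: B]; rewrite big_seq1 => E; rewrite -[G B]/(fine (G B)%:E) -E.
congr (fine (P _)); apply/seteqP; split => [w hw|w Yw [|]] //.
exact: (hw 0%N isT).
Qed.

Let sumY : {ae P, forall w, forall m, (\sum_(l < m) Y l w)%N = S m w}.
Proof.
apply: filterS2 Mgrid0 Mgrid_homo => w w0 homo.
elim => [|m IH]; first by rewrite big_ord0 /S w0 big_ord0.
rewrite big_ord_recr IH /= /Y subnKC // /S -(subnKC (homo m)).
by rewrite big_split_ord leq_addr.
Qed.

Let ballotS : {ae P, forall w, forall n, ballot n.+1 (fun l => Y l w) <->
  forall m, (m < n.+1)%N -> (\sum_(j < M (m.+1%:R * h) w) phi (Z j w) < m.+1)%N}.
Proof.
apply: filterS sumY => w sumYw n; split => [/ballotP b m mn|b].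
  by have := b m mn; rewrite sumYw.
by apply/ballotP => m mn; rewrite sumYw; exact: b.
Qed.

Let meanY (mu : R) : nat_mean P (W 0%N) = mu%:E ->
  nat_mean P (Y 0%N) = (mu * (h * \sum_(j < k) j.+1%:R * lam j))%:E.
Proof.
move=> Wm; have <- : nat_mean P (S 1) = nat_mean P (Y 0%N).
  have mlt (f : T -> nat) b : measurable_fun [set: T] f ->
      measurable [set w | (b < f w)%N].
    by move=> mf; exact: (measurable_preimage (A := [set n | (b < n)%N])).
  rewrite !nat_mean_tail //; apply: eq_eseriesr => b _.
  apply: eq_measure_ae; [exact: mlt|exact: mlt|].
  by apply: filterS sumY => w /(_ 1%N); rewrite big_ord1 /= => <-.
rewrite (wald (m := mu)) //.
  have -> : Mgrid 1 = M h by apply/funext => w; rewrite /Mgrid mul1r.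
  by rewrite (counting_process_mean hk hlam _ hM h_gt0) // -EFinM.
move=> i b; rewrite hZM.
- congr (_ * _)%E.
  by rewrite (hZiid.2 i 0%N (phi @^-1` [set n | (b < n)%N])) //; exact: measurable_preimage.
- apply: (sigma_generated_preimage (i := i) (B := phi @^-1` [set n | (b < n)%N])) => //.
  exact: measurable_preimage.
- apply: (sigma_generated_preimage (X := fun t => M t) (i := 1%:R * h)
    (B := [set n | (i < n)%N])) => //.
  exact: grid_ge0.
Qed.

Lemma survival_ge (mu : R) (A : set T) n :
  nat_mean P (fun w => phi (Z 0%N w)) = mu%:E -> measurable A ->
  {ae P, forall w, (forall m, (m < n.+1)%N ->
     (\sum_(j < M (m.+1%:R * h) w) phi (Z j w) < m.+1)%N) -> A w} ->
  ((1 - mu * (h * \sum_(j < k) j.+1%:R * lam j))%:E <= P A)%E.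
Proof.
move=> /meanY Ym mA hA; apply: le_trans (ballot_prob_ge mY iidY n Ym) _.
apply: le_measure_ae => //; first exact: measurable_ballot.
by apply: filterS2 hA ballotS => w hw /(_ n) [hb _] /hb; exact: hw.
Qed.

Lemma survival_le (mu : R) (A : set T) :
  nat_mean P (fun w => phi (Z 0%N w)) = mu%:E ->
  mu * (h * \sum_(j < k) j.+1%:R * lam j) <= 1 -> measurable A ->
  {ae P, forall w, A w -> forall m,
     (\sum_(j < M (m.+1%:R * h) w) phi (Z j w) < m.+1)%N} ->
  (P A <= (1 - mu * (h * \sum_(j < k) j.+1%:R * lam j))%:E)%E.
Proof.
move=> /meanY Ym m1 mA hA; apply: (ballot_prob_le mY iidY Ym m1 mA) => n.
by apply: filterS2 hA ballotS => w hw /(_ n) [_ hb] Aw; apply: hb => m _; exact: hw.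
Qed.

End discretized_claims.

(** * Survival in continuous time *)

Lemma dyadic_between (R : realType) (a b : R) : 0 <= a -> a < b ->
  exists N i : nat, a < i.+1%:R / 2 ^+ N < b.
Proof.
move=> a0 ab; have ba : 0 < b - a by rewrite subr_gt0.
pose N := Num.truncn (b - a)^-1; pose i := Num.truncn (a * 2 ^+ N).
exists N, i; have N2 : (0 : R) < 2 ^+ N by rewrite exprn_gt0.
rewrite ltr_pdivlMr // ltr_pdivrMr //; apply/andP; split; first exact: truncnS_gt.
have h1 : i%:R <= a * 2 ^+ N by rewrite truncn_le // mulr_ge0 // ltW.
have h2 : 1 < (b - a) * 2 ^+ N.
  rewrite -ltr_pdivrMl // mulr1; apply: lt_le_trans (truncnS_gt _) _.
  by rewrite -natrX ler_nat ltn_expl.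
by rewrite -natr1; lra.
Qed.

Lemma bigcap_probability_ge d (T : measurableType d) (R : realType)
    (P : probability T R) (F : nat -> set T) (x : R) :
  (forall n, measurable (F n)) -> (forall n, F n.+1 `<=` F n) ->
  (forall n, (x%:E <= P (F n))%E) -> (x%:E <= P (\bigcap_n F n))%E.
Proof.
move=> mF Fdec xF.
have mI : measurable (\bigcap_n F n) by exact: bigcapT_measurable.
have ni : nonincreasing_seq F.
  by apply/nonincreasing_seqP => n; apply/subsetPset; exact: Fdec.
have F0 : (P (F 0%N) < +oo)%E by rewrite ltey_eq fin_num_measure.
have cvgF := nonincreasing_cvg_mu F0 mF mI ni.
rewrite -(cvg_lim _ cvgF) //; apply: lime_ge; first by apply/cvg_ex; eexists; exact: cvgF.
exact: nearW.
Qed.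

Section floor_mean.
Context d (T : measurableType d) (R : realType) (P : probability T R).
Variables (Z : {RV P >-> R}) (mu delta : R).
Hypothesis Zpos : {ae P, forall w, 0 < Z w}.
Hypothesis Zmean : ('E_P[Z])%E = mu%:E.
Hypothesis delta_gt0 : 0 < delta.

(** Rounding changes the mean by at most one unit of the lattice. *)
Lemma floor_mean : exists m, [/\ nat_mean P (fun w => Num.truncn (Z w / delta)) = m%:E,
  nat_mean P (fun w => (Num.truncn (Z w / delta)).+1) = (m + 1)%:E &
  m <= mu / delta <= m + 1].
Proof.
(* Z is positive almost surely only, and its truncation is 0 below 0 *)
pose Zp w := Num.max (Z w) 0.
have mZp : measurable_fun [set: T] Zp.
  by apply: measurable_maxr.
have mtr : measurable_fun [set: T] (fun w => Num.truncn (Z w / delta)).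
  apply: (measurableT_comp (@measurable_truncn R)) => //.
  exact: measurable_funM.
have Zp0 w : 0 <= Zp w / delta.
  by rewrite divr_ge0 ?(ltW delta_gt0) // /Zp le_max lexx orbT.
have mZpd : measurable_fun [set: T] (fun w => (Zp w / delta)%:E).
  by apply/measurable_EFinP; exact: measurable_funM.
have Zpm : (\int[P]_w (Zp w / delta)%:E = (mu / delta)%:E)%E.
  transitivity (\int[P]_w ((delta^-1)%:E * (Zp w)%:E))%E.
    by apply: eq_integral => w _; rewrite mulrC EFinM.
  rewrite ge0_integralZl //; last 3 first.
  - exact/measurable_EFinP.
  - by move=> w _; rewrite lee_fin /Zp le_max lexx orbT.
  - by rewrite lee_fin invr_ge0 ltW.
  rewrite mulrC EFinM -Zmean unlock; congr (_ * _)%E.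
  apply: ae_eq_integral => //; do ?exact/measurable_EFinP.
  by apply: filterS Zpos => w Zw _; rewrite /Zp max_l // ltW.
have lo : (nat_mean P (fun w => Num.truncn (Z w / delta)) <= (mu / delta)%:E)%E.
  rewrite -Zpm; apply: ge0_le_integral => //.
  - exact: measurable_natr.
  - move=> w _; rewrite lee_fin; have [Z0|Z0] := leP 0 (Z w).
      by rewrite /Zp max_l // truncn_le // divr_ge0 // ltW.
    rewrite (_ : Num.truncn _ = 0%N) //; apply/truncn0Pn; rewrite -ltNge.
    by rewrite (@lt_trans _ _ 0) // pmulr_llt0 // invr_gt0.
have hi : ((mu / delta)%:E <= nat_mean P (fun w => (Num.truncn (Z w / delta)).+1))%E.
  rewrite -Zpm; apply: ge0_le_integral => //.
  - by move=> w _; rewrite lee_fin; exact: Zp0.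
  - by apply: measurable_natr; exact: (measurableT_comp (f := succn)).
  - move=> w _; rewrite lee_fin /Zp; have [Z0|Z0] := leP (Z w) 0.
      by rewrite mul0r.
    by rewrite ltW // truncnS_gt.
have step : nat_mean P (fun w => (Num.truncn (Z w / delta)).+1) =
    (nat_mean P (fun w => Num.truncn (Z w / delta)) + 1)%E.
  rewrite /nat_mean; under eq_integral do rewrite -natr1 EFinD.
  rewrite ge0_integralD //; last exact: measurable_natr.
  by rewrite integral_cst // mul1e; congr (_ + _)%E; exact: probability_setT.
have fin : nat_mean P (fun w => Num.truncn (Z w / delta)) \is a fin_num.
  rewrite ge0_fin_numE ?(le_lt_trans lo) ?ltry //.
  exact: integral_ge0.
exists (fine (nat_mean P (fun w => Num.truncn (Z w / delta)))).
move: lo hi; rewrite step -(fineK fin) -EFinD !lee_fin => -> ->.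
by split.
Qed.

End floor_mean.

Section ruin.
Context (R : realType) (d : measure_display) (T : measurableType d) (P : probability T R).
Variables (k : nat) (lam : 'I_k -> R) (c : R).
Variables (M : R -> {RV P >-> nat}) (Z : nat -> {RV P >-> R}) (mu : R).
Hypothesis hk : (1 <= k)%N.
Hypothesis hlam : forall j, 0 < lam j.
Hypothesis hc : 0 < c.
Hypothesis hM : generalized_counting_process P lam (fun t => M t).
Hypothesis hZpos : forall j, {ae P, forall w, 0 < Z j w}.
Hypothesis hZiid : iid P (fun j => Z j).
Hypothesis hZM : independent_families P [set: nat] (fun j => Z j)
             [set t : R | 0 <= t] (fun t => M t).
Hypothesis hmu : ('E_P[Z 0%N])%E = mu%:E.
Hypothesis hnet : mu * \sum_(j < k) j.+1%:R * lam j <= c.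

Let rate := \sum_(j < k) j.+1%:R * lam j.
Let claims t w := \sum_(j < M t w) Z j w.

Let rate_ge0 : 0 <= rate.
Proof. by apply: sumr_ge0 => j _; rewrite mulr_ge0 // ltW. Qed.

Let m_claims t : measurable_fun [set: T] (claims t).
Proof.
apply: (measurable_random_index (F := fun m w => \sum_(j < m) Z j w)) => // m.
exact: measurable_sum.
Qed.

Definition survival : set T := [set w | forall t, 0 < t -> claims t w <= c * t].

Definition dyadic_survival (N : nat) : set T :=
  [set w | forall i, claims (i.+1%:R * (2 ^+ N)^-1) w <= c * (i.+1%:R * (2 ^+ N)^-1)].

Definition dyadic_survival_upto (N n : nat) : set T :=
  [set w | forall i, (i < n.+1)%N ->
    claims (i.+1%:R * (2 ^+ N)^-1) w <= c * (i.+1%:R * (2 ^+ N)^-1)].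

Let m_claims_le t x : measurable [set w | claims t w <= x].
Proof.
rewrite (_ : [set w | _] = claims t @^-1` `]-oo, x]); first exact: measurable_preimage.
by apply/seteqP; split => w; rewrite /= in_itv.
Qed.

Let m_upto N n : measurable (dyadic_survival_upto N n).
Proof.
exact: (measurable_forall (D := [set i | (i < n.+1)%N]) (E := fun i =>
  [set w | claims (i.+1%:R * (2 ^+ N)^-1) w <= c * (i.+1%:R * (2 ^+ N)^-1)])).
Qed.

Let dyadic_survivalE N : dyadic_survival N = \bigcap_n dyadic_survival_upto N n.
Proof.
by apply/seteqP; split => [w hw n _ i _|w hw i]; [exact: hw|exact: (hw i)].
Qed.

Let m_dyadic N : measurable (dyadic_survival N).
Proof. by rewrite dyadic_survivalE; exact: bigcapT_measurable. Qed.

Let dyadic_dec N : dyadic_survival N.+1 `<=` dyadic_survival N.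
Proof.
move=> w hw i; have := hw (i.+1.*2.-1)%N; rewrite prednK ?double_gt0 //.
rewrite (_ : i.+1.*2%:R * _ = i.+1%:R * (2 ^+ N)^-1) //.
rewrite -muln2 natrM exprS; field.
by rewrite expf_neq0.
Qed.

(** If the claims exceed [c * t] at some time [t], then they do so during a
    whole interval after [t]: the path of [M] is right-continuous with values
    in the natural numbers, hence constant for a while after [t], and
    [c * s] is continuous in [s].  This interval contains a dyadic time. *)
Let survivalE : survival = \bigcap_N dyadic_survival N.
Proof.
apply/seteqP; split => [w hw N _ i|w hw t t0].
  by apply: hw; rewrite mulr_gt0 // invr_gt0 exprn_gt0.
rewrite leNgt; apply/negP => ruin.
have [_ _ _ _ /(_ w) [/(_ t (ltW t0)) rc _]] := hM.1.
have Mt : \forall s \near t^'+, M s w = M t w.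
  move/cvgrPdist_lt : rc => /(_ 1 ltr01); apply: filterS => s /=.
  have -> : (M t w)%:R - (M s w)%:R = ((M t w)%:Z - (M s w)%:Z)%:~R :> R.
    by rewrite rmorphB.
  by rewrite -intr_norm (ltr_int R _ 1); lia.
have [e e0 he] : exists2 e, 0 < e & forall s, t < s -> s < t + e -> M s w = M t w.
  have [e /= e0 he] : exists2 e, 0 < e & ball t e `<=` [set s | t < s -> M s w = M t w].
    by apply/nbhs_ballP; exact: Mt.
  exists e => // s ts se; apply: he => //.
  by rewrite /ball /= ltr0_norm ?subr_lt0 // opprB ltrBlDl.
have [|N [i /andP[ts sb]]] := @dyadic_between R t (Num.min (t + e) (claims t w / c)) (ltW t0).
  by rewrite lt_min ltrDl e0 ltr_pdivlMr // mulrC.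
have {sb} [se sc] : i.+1%:R / 2 ^+ N < t + e /\ i.+1%:R / 2 ^+ N < claims t w / c.
  by move: sb; rewrite lt_min => /andP[].
have := hw N I i; rewrite /claims (he _ ts se) leNgt => /negP; apply.
by rewrite mulrC -ltr_pdivlMr.
Qed.

(** Claims rounded up to multiples of [delta = c * h] can only increase the
    total, and the strict ballot condition for them implies survival on the
    grid.  The error term is the effect of the rounding on the mean. *)
Let dyadic_survival_ge N :
  ((1 - mu / c * rate - rate * (2 ^+ N)^-1)%:E <= P (dyadic_survival N))%E.
Proof.
rewrite dyadic_survivalE; apply: bigcap_probability_ge => // n.
  by move=> w hw i i_n; apply: hw; rewrite ltnS ltnW.
pose h : R := (2 ^+ N)^-1; pose delta := c * h.
have h0 : 0 < h by rewrite invr_gt0 exprn_gt0.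
have delta0 : 0 < delta by rewrite mulr_gt0.
have [m [_ mS /andP[mle _]]] := floor_mean (hZpos 0%N) hmu delta0.
pose phi (z : R) := (Num.truncn (z / delta)).+1.
have mphi : measurable_fun [set: R] phi.
  apply: (measurableT_comp (f := succn)) => //.
  apply: (measurableT_comp (@measurable_truncn R)) => //.
  exact: measurable_funM.
apply: le_trans (survival_ge hk hlam hM hZiid hZM mphi h0 (n := n) mS _ _) => //.
  rewrite lee_fin -/rate -/h.
  have : (m + 1) * (h * rate) <= (mu / delta + 1) * (h * rate).
    by rewrite ler_wpM2r ?lerD2r // mulr_ge0 // ltW.
  rewrite (_ : (mu / delta + 1) * (h * rate) = mu / c * rate + rate * h); first by lra.
  by rewrite /delta; field; rewrite !gt_eqF.
apply: aeW => w hw i i_n; rewrite -/h.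
apply: (@le_trans _ _ (\sum_(j < M (i.+1%:R * h) w) delta * (phi (Z j w))%:R)).
  apply: ler_sum => j _; rewrite [leRHS]mulrC -ler_pdivrMr //.
  by rewrite ltW // truncnS_gt.
rewrite -mulr_sumr -natr_sum (_ : c * (i.+1%:R * h) = delta * i.+1%:R); last first.
  by rewrite /delta; ring.
by rewrite ler_wpM2l ?(ltW delta0) // ler_nat ltnW // hw.
Qed.

Let m_survival : measurable survival.
Proof. by rewrite survivalE; exact: bigcapT_measurable. Qed.

Let survival_prob_ge : ((1 - mu / c * rate)%:E <= P survival)%E.
Proof.
rewrite survivalE; apply: bigcap_probability_ge => // N.
have PN : P (dyadic_survival N) \is a fin_num by rewrite fin_num_measure.
rewrite -(fineK PN) lee_fin; apply/ler_addgt0Pr => e e0.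
have dec K : dyadic_survival (N + K) `<=` dyadic_survival N.
  elim: K => [|K IH]; first by rewrite addn0.
  by rewrite addnS => w /dyadic_dec /IH.
(* a refinement of the grid for which the rounding error is at most e *)
pose K := Num.truncn (rate / e).
rewrite -lerBlDr -lee_fin fineK //.
apply: (@le_trans _ _ (P (dyadic_survival (N + K)))); last first.
  by apply: le_measure; rewrite ?inE //; exact: dec.
apply: le_trans (dyadic_survival_ge (N + K)); rewrite lee_fin lerD2l lerN2.
rewrite ler_pdivrMr ?exprn_gt0 // mulrC -ler_pdivrMr //.
apply: ltW; apply: lt_le_trans (truncnS_gt _) _.
by rewrite -natrX ler_nat (leq_trans (ltn_expl K (isT : 1 < 2)%N)) // leq_exp2l // leq_addl.
Qed.

(** Claims rounded down to multiples of [delta = c' * h] keep the total below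
    [c * t < c' * t] on survival, so that the strict ballot condition holds at
    every point of the grid. *)
Let survival_bound (delta c' : R) : 0 < delta -> c < c' ->
  (P survival <= (1 - (mu - delta) * rate / c')%:E)%E.
Proof.
move=> delta0 cc'; have c'0 : 0 < c' by rewrite (lt_trans hc).
pose h := delta / c'; have h0 : 0 < h by rewrite divr_gt0.
have [m [mE _ /andP[mlo mhi]]] := floor_mean (hZpos 0%N) hmu delta0.
pose phi (z : R) := Num.truncn (z / delta).
have mphi : measurable_fun [set: R] phi.
  apply: (measurableT_comp (@measurable_truncn R)) => //.
  exact: measurable_funM.
have hr0 : 0 <= h * rate by rewrite mulr_ge0 // ltW.
apply: le_trans (survival_le hk hlam hM hZiid hZM mphi h0 mE _ m_survival _) _.
- apply: (@le_trans _ _ (mu / delta * (h * rate))); first by rewrite ler_wpM2r.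
  rewrite (_ : mu / delta * (h * rate) = mu * rate / c'); last first.
    by rewrite /h; field; rewrite !gt_eqF.
  by rewrite ler_pdivrMr // mul1r (le_trans hnet) // ltW.
- apply: filterS (ae_foralln hZpos) => w Zw surv i.
  have t0 : 0 < i.+1%:R * h by rewrite mulr_gt0.
  rewrite -(ltr_nat R) natr_sum -(ltr_pM2l delta0) mulr_sumr.
  apply: (@le_lt_trans _ _ (claims (i.+1%:R * h) w)).
    apply: ler_sum => j _; rewrite [leLHS]mulrC -ler_pdivlMr //.
    by rewrite truncn_le // divr_ge0 // ltW.
  apply: le_lt_trans (surv _ t0) _.
  rewrite (_ : delta * i.+1%:R = c' * (i.+1%:R * h)); last first.
    by rewrite /h; field; rewrite gt_eqF.
  by rewrite ltr_pM2r.
rewrite lee_fin lerD2l lerN2 -/rate.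
apply: (@le_trans _ _ ((mu / delta - 1) * (h * rate))).
  rewrite (_ : (mu / delta - 1) * (h * rate) = (mu - delta) * rate / c') //.
  by rewrite /h; field; rewrite !gt_eqF.
by rewrite ler_wpM2r // lerBlDr.
Qed.

(** The limit of [survival_bound] along [delta = x], [c' = c + x]. *)
Let survival_prob_le : (P survival <= (1 - mu / c * rate)%:E)%E.
Proof.
have Pfin : P survival \is a fin_num by rewrite fin_num_measure.
rewrite -(fineK Pfin) lee_fin; set p := fine _.
have p1 : p <= 1 by rewrite -lee_fin fineK // probability_le1.
have K0 : 0 < rate + 1 - p + 1 by rewrite ltr_wpDl // -addrA addr_ge0 // subr_ge0.
suff : (p - 1) * c + mu * rate <= 0.
  move=> le0; rewrite -[p <= _](ler_pM2r hc).
  rewrite (_ : (1 - _) * c = c - mu * rate); first by lra.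
  by field; rewrite gt_eqF.
apply/ler_addgt0Pr => e e0; rewrite add0r.
pose x := e / (rate + 1 - p + 1).
have x0 : 0 < x by rewrite divr_gt0.
have xE : x * (rate + 1 - p + 1) = e by rewrite divfK // gt_eqF.
have cx0 : 0 < c + x by rewrite addr_gt0.
have := @survival_bound x (c + x) x0; rewrite ltrDl => /(_ x0).
rewrite -(fineK Pfin) lee_fin -/p -(ler_pM2r cx0) mulrBl mul1r divfK ?gt_eqF //.
rewrite -xE; lra.
Qed.

Lemma survival_prob : P survival = (1 - mu / c * rate)%:E.
Proof. by apply/eqP; rewrite eq_le survival_prob_le survival_prob_ge. Qed.

Lemma ruin_set :
  [set w | (ruin_time (risk_model c (fun t => M t) (fun j => Z j)) 0 w < +oo)%E] =
  ~` survival.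
Proof.
apply/seteqP; split => w /=.
  move=> fin surv; move: fin; rewrite /ruin_time.
  rewrite (_ : [set t | _] = set0) ?image_set0 ?ereal_inf0 //.
  apply/seteqP; split => // t [t0]; rewrite /surplus /risk_model add0r subr_lt0.
  by rewrite ltNge => /negP; apply; exact: surv.
move=> nsurv; have [t [t0 ruin]] : exists t, 0 < t /\ c * t < claims t w.
  apply: contrapT => h; apply: nsurv => t t0; rewrite leNgt; apply/negP => lt.
  by apply: h; exists t.
apply: (@le_lt_trans _ _ t%:E); last exact: ltry.
apply: ereal_inf_lbound; exists t => //; split => //.
by rewrite /surplus /risk_model add0r subr_lt0.
Qed.

Lemma ruin_prob :
  ruin_probability P (risk_model c (fun t => M t) (fun j => Z j)) 0 =
  (mu / c * rate)%:E.
Proof.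
rewrite /ruin_probability ruin_set probability_setC // survival_prob.
by rewrite -EFinB opprB addrC subrK.
Qed.

End ruin.

(* [hnet] is the usual net profit condition (non-strict form): the formula
   cannot hold without it, as its right-hand side would exceed 1. *)
Theorem corollary5p1 (R : realType) (d : measure_display)
    (T : measurableType d) (P : probability T R)
    (k : nat) (hk : (1 <= k)%N)
    (lam : 'I_k -> R) (hlam : forall j, 0 < lam j)
    (c : R) (hc : 0 < c)
    (M : R -> {RV P >-> nat})
    (hM : generalized_counting_process P lam (fun t => M t))
    (Z : nat -> {RV P >-> R})
    (hZpos : forall j, {ae P, forall w, 0 < Z j w})
    (hZiid : iid P (fun j => Z j))
    (hZM : independent_families P [set: nat] (fun j => Z j)
             [set t : R | 0 <= t] (fun t => M t))
    (mu : R) (hmu : ('E_P[Z 0%N])%E = mu%:E)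
    (hnet : mu * \sum_(j < k) j.+1%:R * lam j <= c) :
  ruin_probability P (risk_model c (fun t => M t) (fun j => Z j)) 0 =
  (mu / c * \sum_(j < k) j.+1%:R * lam j)%:E.
Proof.
exact: (ruin_prob hk hlam hc hM hZpos hZiid hZM hmu hnet).
Qed.
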